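(* $$\lim_{p\to\infty}\frac{\|P_1^+\|_{\infty,p}}{p}=\frac{1}{\pi e}.$$
   Context: Let $\mathbb{T}=\{\zeta\in\mathbb{C}:|\zeta|=1\}$ with Lebesgue measure $\sigma_1$ normalized so that $\sigma_1(\mathbb{T})=1$; $L^p(\mathbb{T})$ denotes the space of complex-valued functions with norm $\|f\|_p$ computed with respect to $\sigma_1$. For $f\in L^2(\mathbb{T})$ with Fourier series $f(\zeta)=\sum_{k\in\mathbb{Z}}\hat f(k)\zeta^k$, the Riesz projection is $P_1^+f(\zeta)=\sum_{k\ge 0}\hat f(k)\zeta^k$ (the sum includes $k=0$). For $2\le p<\infty$, $\|P_1^+\|_{\infty,p}$ denotes the norm of the operator $P_1^+:L^\infty(\mathbb{T})\to L^p(\mathbb{T})$, i.e. $\|P_1^+\|_{\infty,p}=\sup\{\|P_1^+f\|_p: f\in L^\infty(\mathbb{T}),\ \|f\|_\infty\le 1\}$. *)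

(* Defs.v *)
(* MathComp-Analysis, over an arbitrary [R : realType], with the complex numbers
   [R[i]] of mathcomp-real-closed. *)
From HB Require Import structures.
From mathcomp Require Import all_boot all_order all_algebra.
From mathcomp Require Import all_classical all_reals all_analysis.
From mathcomp Require Import complex.

Set Implicit Arguments.
Unset Strict Implicit.
Unset Printing Implicit Defensive.
Import Order.TTheory GRing.Theory Num.Theory.
Import numFieldNormedType.Exports.

Local Open Scope classical_set_scope.
Local Open Scope complex_scope.
Local Open Scope ring_scope.

Definition circle (R : realType) : Type := {z : R[i] | `|z| == 1}.

HB.instance Definition _ (R : realType) := Choice.on (circle R).

Lemma cis_subproof (R : realType) (t : R) : `|cos t +i* sin t| == 1 :> R[i].
Proof. by rewrite normc_def /= cos2Dsin2 sqrtr1. Qed.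

Definition cis (R : realType) (t : R) : circle R :=
  exist _ (cos t +i* sin t) (cis_subproof t).

HB.instance Definition _ (R : realType) := isPointed.Build (circle R) (cis 0).

(* [R[i]^o] is the copy of [R[i]] that carries the topology of the modulus. *)
HB.instance Definition _ (R : realType) :=
  Topological.copy (circle R) (initial_topology (val : circle R -> R[i]^o)).

(* Borel sigma-algebra *)
HB.instance Definition _ (R : realType) :=
  Measurable.copy (circle R) (g_sigma_algebraType (@open (circle R))).

Lemma normc_le_sum (R : realType) (z : R[i]) :
  `|z| <= (`|complex.Re z| + `|complex.Im z|)%:C.
Proof.
rewrite normc_def lecR -[leRHS]ger0_norm ?addr_ge0// -sqrtr_sqr ler_wsqrtr//.
by rewrite sqrrD !real_normK ?num_real// addrAC lerDl mulrn_wge0// mulr_ge0.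
Qed.

Lemma cis_continuous (R : realType) : continuous (@cis R).
Proof.
apply/continuousP => /= _ [V oV <-].
rewrite -comp_preimage.
have cc : continuous ((val : circle R -> R[i]^o) \o @cis R).
  move=> t; apply/cvgrPdist_lt => e e0.
  have /andP[/eqP e_im e_re] : (complex.Im e == 0) && (0 < complex.Re e).
    by move: e0; rewrite ltcE /= eq_sym.
  have eE : e = (complex.Re e / 2 + complex.Re e / 2)%:C.
    by apply/eqP; rewrite eq_complex /= -splitr e_im !eqxx.
  have e2 : 0 < complex.Re e / 2 by rewrite divr_gt0.
  near=> s; rewrite eE; apply: le_lt_trans (normc_le_sum _) _.
  rewrite ltcR ltrD//=; near: s.
    by have /cvgrPdist_lt := @continuous_cos R t; exact.
  by have /cvgrPdist_lt := @continuous_sin R t; exact.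
by move/continuousP : cc; exact.
Unshelve. all: by end_near. Qed.

Lemma measurable_cis (R : realType) :
  measurable_fun [set: measurableTypeR R] (@cis R).
Proof.
apply: (@measurability _ _ _ _ _ _ (@open (circle R))) => //.
move=> _ [A oA <-]; rewrite setTI.
apply: measurable_realfun.open_measurable.
by have /continuousP := @cis_continuous R; apply.
Qed.

Definition cis_mfun (R : realType) : {mfun measurableTypeR R >-> circle R} :=
  HB.pack (@cis R) (isMeasurableFun.Build _ _ _ _ _ (@measurable_cis R)).

Lemma pi2_gt0 (R : realType) : 0 < 2 * pi :> R.
Proof. by rewrite mulr_gt0 ?pi_gt0. Qed.

(* Normalized arc length: the law of [cis t] for [t] uniform on [[0, 2 pi]]. *)
Definition sigma1 (R : realType) : probability (circle R) R :=
  distribution (uniform_prob (pi2_gt0 R)) (cis_mfun R).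

Section RieszProjection.
Context {R : realType}.
Implicit Types (f g : circle R -> R[i]) (p : \bar R) (k : int).

Definition cmeasurable f :=
  measurable_fun [set: circle R] (fun z => complex.Re (f z)) /\
  measurable_fun [set: circle R] (fun z => complex.Im (f z)).

Definition cLnorm p f : \bar R :=
  'N[sigma1 R]_p[EFin \o (@Normc.normc R \o f)]%E.

Definition in_cL p f := cmeasurable f /\ (cLnorm p f < +oo)%E.

Definition cintegral f : R[i] :=
  (\int[sigma1 R]_z complex.Re (f z)) +i* (\int[sigma1 R]_z complex.Im (f z)).

Definition fourier_coef f k : R[i] := cintegral (fun z => f z * val z ^ (- k)).

Definition riesz_partial f (n : nat) : circle R -> R[i] :=
  fun z => \sum_(0 <= k < n) fourier_coef f k%:Z * val z ^+ k.

(* [g] is a representative of the sum, in [L^2], of the Fourier series of [f]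
   restricted to nonnegative frequencies. *)
Definition is_riesz_projection f g :=
  in_cL 2%:E g /\
  cLnorm 2%:E (fun z => riesz_partial f n z - g z) @[n --> \oo] --> 0%E.

(* For [f] in [L^2] such a [g] exists and is unique up to equality almost
   everywhere. *)
Definition riesz_projection f : circle R -> R[i] :=
  xget (fun=> 0) [set g | is_riesz_projection f g].

Definition riesz_opnorm p : \bar R :=
  ereal_sup [set cLnorm p (riesz_projection f) |
             f in [set f | in_cL +oo f /\ (cLnorm +oo f <= 1)%E]].

End RieszProjection.

(* Main.v *)
(* Upper bound.  Let [f] be a trigonometric polynomial with [`|f| <= 1], written
   [f = F + G^*] with [F = P f] and [G] analytic, [G 0 = 0].  For [0 < c < pi] the
   function [cos (c sqrt (F G))] is analytic with value [1] at [0], so it has mean [1]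
   on the circle.  Since [F G = F f^* - `|F| ^ 2], a square root [x + i y] of [- F G]
   satisfies [`|y| <= 1 / 2] and [`|x| >= `|F| - 1], so the real part
   [cosh (c x) cos (c y)] of this function is at least
   [cos (c / 2) / 2 * exp (c (`|F| - 1))].  Thus the integral of [exp (c `|F|)] is
   bounded by a constant [K c].  Fejer means extend this to every [f] with
   [`|f| <= 1], and [r ^ p <= (p / (c e)) ^ p exp (c r)] gives
   [||P f||_p <= p / (c e) * K c ^ (1 / p)].

   Lower bound.  For the [n]-th Fejer mean [f] of the sawtooth [1 - t / pi] on
   [[0, 2 pi]], [`|P f| >= (ln n - 2) / pi] on an arc of length [1 / n]; with
   [n ~ exp p] this yields [||P f||_p >= (p - 2) / (pi e) * (4 pi) ^ (- 1 / p)]. *)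
Require Import Defs.
From mathcomp Require Import all_boot all_order all_algebra.
From mathcomp Require Import all_classical all_reals all_analysis.
From mathcomp Require Import measurable_realfun ess_sup_inf complex ring lra zify.
From Stdlib Require Import Lia.
Import Order.TTheory GRing.Theory Num.Theory.
Import numFieldNormedType.Exports.
Local Open Scope classical_set_scope.
Local Open Scope ring_scope.

Set Implicit Arguments.
Unset Strict Implicit.

(** Both bounds meet at [c = pi] for one reason: the projection of the sawtooth grows like
    [ln (1 / t) / pi] at the jump, so [exp (c |P f|)] behaves there like [t ^ (- c / pi)], which is
    integrable exactly for [c < pi]. The constant [K c = 2 exp c / cos (c / 2)] blows up as [c]
    tends to [pi]; hence [c] stays fixed while [p] tends to infinity, which sends [K c ^ (1 / p)] to
    1, and only then is [c] taken close to [pi]. The factor [1 / e] is the maximum of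
    [r ^ p exp (- c r)] at [r = p / c] above, and that of [(ln n) ^ p / n] at [ln n = p] below. A
    square root of [F G] is in general not analytic. Since the cosine is even, it is replaced by
    polynomials in [F G], uniformly close to it on the circle, and the mean of a polynomial is its
    value at 0. Fejer means are used, rather than partial sums, because they preserve [|f| <= 1];
    their analytic halves are averages of the partial sums of [P f] and so converge to it in
    [L^1]. *)

Local Notation normc := Normc.normc.
Local Notation Re := complex.Re.
Local Notation Im := complex.Im.

(** * Moduli of complex numbers and the unit circle *)

Section ComplexModulus.
Context {R : realType}.
Implicit Types z w : R[i].

Lemma normcE z : `|z| = (normc z)%:C%C.
Proof. by []. Qed.

Lemma normc_ge0 z : 0 <= normc z.
Proof. by rewrite -lecR -normcE normr_ge0. Qed.

Lemma normcX z n : normc (z ^+ n) = normc z ^+ n.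
Proof. by elim: n => [|n ih]; rewrite ?expr0 ?Normc.normc1// !exprS Normc.normcM ih. Qed.

Lemma normcD_le z w : normc (z + w) <= normc z + normc w.
Proof. exact: le_normcD. Qed.

Lemma normcNE z : normc (- z) = normc z.
Proof. exact: normcN. Qed.

Lemma normc_distC z w : normc (z - w) = normc (w - z).
Proof. by rewrite -normcNE opprB. Qed.

Lemma normc_sum_le (I : Type) (r : seq I) (P : pred I) (F : I -> R[i]) :
  normc (\sum_(i <- r | P i) F i) <= \sum_(i <- r | P i) normc (F i).
Proof.
elim/big_ind2 : _ => [|x a y b xa yb|//]; first by rewrite Normc.normc0.
by rewrite (le_trans (normcD_le _ _))// lerD.
Qed.

Lemma normc_sqrE z : normc z ^+ 2 = Re z ^+ 2 + Im z ^+ 2.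
Proof. by case: z => a b /=; rewrite sqr_sqrtr// addr_ge0// sqr_ge0. Qed.

Lemma normc_real (x : R) : normc (x%:C)%C = `|x|.
Proof. by rewrite /= expr0n addr0 sqrtr_sqr. Qed.

Lemma ler_norm_Re z : `|Re z| <= normc z.
Proof.
by rewrite -ler_sqr ?nnegrE ?normc_ge0// real_normK ?num_real// normc_sqrE lerDl sqr_ge0.
Qed.

Lemma ler_norm_Im z : `|Im z| <= normc z.
Proof.
by rewrite -ler_sqr ?nnegrE ?normc_ge0// real_normK ?num_real// normc_sqrE lerDr sqr_ge0.
Qed.

Lemma normc_conj z : normc z^*%C = normc z.
Proof. by case: z => a b /=; rewrite sqrrN. Qed.

Lemma mulc_conj z : z * z^*%C = ((normc z ^+ 2)%:C)%C.
Proof.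
rewrite normc_sqrE; case: z => a b; apply/eqP; rewrite eq_complex /=.
by apply/andP; split; apply/eqP; ring.
Qed.

Lemma reD z w : Re (z + w) = Re z + Re w.
Proof. by case: z; case: w. Qed.

Lemma reN z : Re (- z) = - Re z.
Proof. by case: z. Qed.

Lemma imD z w : Im (z + w) = Im z + Im w.
Proof. by case: z; case: w. Qed.

Lemma reM z w : Re (z * w) = Re z * Re w - Im z * Im w.
Proof. by case: z; case: w. Qed.

Lemma imM z w : Im (z * w) = Re z * Im w + Im z * Re w.
Proof. by case: z; case: w. Qed.

Lemma normc_le_ReIm z : normc z <= `|Re z| + `|Im z|.
Proof. by rewrite -lecR -normcE; exact: normc_le_sum. Qed.

Lemma invc_conj z : normc z = 1 -> z^-1 = z^*%C.
Proof.
move=> z1; have z0 : z != 0.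
  by apply: contra_eq_neq z1 => ->; rewrite Normc.normc0 eq_sym oner_neq0.
by apply: (mulfI z0); rewrite mulfV// mulc_conj z1 expr1n.
Qed.

End ComplexModulus.

Section Circle.
Context {R : realType}.
Implicit Types z w : circle R.

Lemma normc_circle z : normc (val z) = 1.
Proof. by case: z => z /= /eqP; rewrite normcE => -[]. Qed.

Lemma circle_neq0 z : val z != 0.
Proof.
by apply/eqP => z0; have := normc_circle z; rewrite z0 Normc.normc0 => /eqP; rewrite eq_sym oner_eq0.
Qed.

Lemma circleV z : (val z)^-1 = (val z)^*%C.
Proof. by rewrite invc_conj// normc_circle.
Qed.

Lemma normc_circleX z (k : int) : normc (val z ^ k) = 1.
Proof.
case: k => k; first by rewrite -exprnP normcX normc_circle expr1n.
by rewrite NegzE -exprnN Normc.normcV normcX normc_circle expr1n invr1.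
Qed.

(** The symmetric interval is the one on which [norm_saw_le] bounds the odd function [saw]. The sign
    of the imaginary part decides between [acos a] and its opposite. *)
Lemma circle_cis z : exists t : R, [/\ - pi <= t, t <= pi & z = cis t].
Proof.
have := normc_circle z; move=> nz.
have : Re (val z) ^+ 2 + Im (val z) ^+ 2 = 1 by rewrite -normc_sqrE nz expr1n.
set a := Re _; set b := Im _ => ab.
have a1 : -1 <= a <= 1.
  by rewrite -ler_norml -nz ler_norm_Re.
have [/andP[t0 tpi] ct] := acos_def a1.
have s2 : sin (acos a) ^+ 2 = b ^+ 2.
  by rewrite sin2cos2 ct -ab; ring.
have sE : Num.sqrt (1 - a ^+ 2) = `|b| by rewrite -ab addrC addKr sqrtr_sqr.
have [b0|b0] := leP 0 b.
  exists (acos a); split => //; first by rewrite (le_trans _ t0)// oppr_le0 pi_ge0.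
  apply/val_inj/eqP; rewrite eq_complex /= ct sin_acos// sE ger0_norm//.
  by rewrite !eqxx.
exists (- acos a); split.
- by rewrite lerN2.
- by rewrite (le_trans _ (pi_ge0 _))// oppr_le0.
- apply/val_inj/eqP; rewrite eq_complex /= cosN sinN ct sin_acos// sE ltr0_norm//.
  by rewrite opprK !eqxx.
Qed.

Lemma cisX (t : R) n :
  val (cis t) ^+ n = Complex (cos (n%:R * t)) (sin (n%:R * t)).
Proof.
elim: n => [|n ih]; first by rewrite expr0 mul0r cos0 sin0.
rewrite exprS ih -natr1 mulrDl mul1r cosD sinD /=.
by apply/eqP; rewrite eq_complex /=; apply/andP; split; apply/eqP; ring.
Qed.

End Circle.

Section CircleMeasurability.
Context {R : realType}.

Lemma continuous_Re : continuous (@complex.Re R : R[i]^o -> R).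
Proof.
move=> z; have Fz : Filter (nbhs (z : R[i]^o)) by exact: nbhs_filter.
apply/(@cvgrPdist_lt _ _ _ (nbhs (z : R[i]^o)) Fz) => e e0.
have e0' : 0 < (e%:C)%C :> R[i] by rewrite ltcR.
apply/nbhs_ballP; exists (e%:C)%C => // w.
rewrite -ball_normE /= -[X in X < _ -> _]/`|z - w| normcE ltcR; apply: le_lt_trans.
by have := ler_norm_Re (z - w); case: (z) => a b; case: (w).
Qed.

Lemma continuous_Im : continuous (@complex.Im R : R[i]^o -> R).
Proof.
move=> z; have Fz : Filter (nbhs (z : R[i]^o)) by exact: nbhs_filter.
apply/(@cvgrPdist_lt _ _ _ (nbhs (z : R[i]^o)) Fz) => e e0.
have e0' : 0 < (e%:C)%C :> R[i] by rewrite ltcR.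
apply/nbhs_ballP; exists (e%:C)%C => // w.
rewrite -ball_normE /= -[X in X < _ -> _]/`|z - w| normcE ltcR; apply: le_lt_trans.
by have := ler_norm_Im (z - w); case: (z) => a b; case: (w).
Qed.

Lemma continuous_measurable_circle (h : circle R -> R) :
  continuous h -> measurable_fun [set: circle R] h.
Proof.
move=> ch; apply: (measurability _ (RGenOpens.measurableE R)) => //.
move=> _ [_ [x [y ->]] <-]; rewrite setTI; apply: sub_sigma_algebra.
by move/continuousP : ch; apply; exact: interval_open.
Qed.

Lemma cmeasurable_val : cmeasurable (fun z : circle R => val z).
Proof.
split; apply: continuous_measurable_circle => z.
  apply: (@continuous_comp _ _ _ (val : circle R -> R[i]^o) (@complex.Re R)); last exact: continuous_Re.
  exact: initial_continuous.
apply: (@continuous_comp _ _ _ (val : circle R -> R[i]^o) (@complex.Im R)); last exact: continuous_Im.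
exact: initial_continuous.
Qed.

Implicit Types f g : circle R -> R[i].

Lemma cmeasurable_cst (a : R[i]) : cmeasurable (fun=> a : R[i]).
Proof. by split; exact: measurable_cst. Qed.

Lemma cmeasurableD f g : cmeasurable f -> cmeasurable g ->
  cmeasurable (fun z => f z + g z).
Proof.
move=> [f1 f2] [g1 g2]; split.
  under eq_fun do rewrite reD; exact: measurable_funD.
under eq_fun do rewrite imD; exact: measurable_funD.
Qed.

Lemma cmeasurableM f g : cmeasurable f -> cmeasurable g ->
  cmeasurable (fun z => f z * g z).
Proof.
move=> [f1 f2] [g1 g2]; split.
  under eq_fun do rewrite reM.
  by apply: measurable_funB; exact: measurable_funM.
under eq_fun do rewrite imM; by apply: measurable_funD; exact: measurable_funM.
Qed.

Lemma cmeasurableN f : cmeasurable f -> cmeasurable (fun z => - f z).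
Proof.
move=> mf; under eq_fun do rewrite -mulN1r.
exact: (cmeasurableM (cmeasurable_cst _)).
Qed.

Lemma cmeasurable_conj f : cmeasurable f -> cmeasurable (fun z => (f z)^*%C).
Proof.
move=> [f1 f2]; split.
  rewrite [X in measurable_fun _ X](_ : _ = fun z => Re (f z))//.
  by apply/funext => z; case: (f z).
rewrite [X in measurable_fun _ X](_ : _ = fun z => - Im (f z)).
  exact: measurableT_comp.
by apply/funext => z; case: (f z).
Qed.

Lemma cmeasurable_sum (I : Type) (r : seq I) (P : pred I) (F : I -> circle R -> R[i]) :
  (forall i, cmeasurable (F i)) -> cmeasurable (fun z => \sum_(i <- r | P i) F i z).
Proof.
move=> mF; elim: r => [|i r ih].
  by under eq_fun do rewrite big_nil; exact: cmeasurable_cst.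
under eq_fun do rewrite big_cons.
by case: (P i) => //; exact: cmeasurableD.
Qed.

Lemma cmeasurableX f n : cmeasurable f -> cmeasurable (fun z => f z ^+ n).
Proof.
move=> mf; elim: n => [|n ih]; first exact: cmeasurable_cst.
by under eq_fun do rewrite exprS; exact: cmeasurableM.
Qed.

Lemma cmeasurable_circleX (k : int) : cmeasurable (fun z : circle R => val z ^ k).
Proof.
case: k => k; first exact: cmeasurableX cmeasurable_val.
rewrite [X in cmeasurable X](_ : _ = fun z => (val z)^*%C ^+ k.+1).
  exact: cmeasurableX (cmeasurable_conj cmeasurable_val).
by apply/funext => z; rewrite NegzE -exprnN -exprVn circleV.
Qed.

Lemma measurable_normc f : cmeasurable f -> measurable_fun [set: circle R] (fun z => normc (f z)).
Proof.
move=> [f1 f2].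
rewrite [X in measurable_fun _ X](_ : _ = fun z => Num.sqrt (Re (f z) ^+ 2 + Im (f z) ^+ 2)).
  apply: (@measurableT_comp _ _ _ _ _ _ (@Num.sqrt R)).
    by apply: continuous_measurable_fun; exact: sqrt_continuous.
  by apply: measurable_funD; exact: measurable_funX.
by apply/funext => z; case: (f z).
Qed.

End CircleMeasurability.

(** * Integration on the circle *)

Section CircleIntegral.
Context {R : realType}.
Implicit Types f g : circle R -> R[i].

Lemma ge0_integral_sigma1 (h : circle R -> R) :
  measurable_fun [set: circle R] h -> (forall z, 0 <= h z) ->
  (\int[sigma1 R]_z (h z)%:E =
   ((2 * pi)^-1)%:E * \int[lebesgue_measure]_(t in `[0%R, (2 * pi)%R]) (h (cis t))%:E)%E.
Proof.
move=> mh h0.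
rewrite ge0_integral_pushforward//=; last 3 first.
- exact: measurable_cis.
- exact: measurableT_comp.
- by move=> z _; rewrite lee_fin.
rewrite preimage_setT integral_uniform ?subr0//.
  apply: measurableT_comp => //; exact: measurableT_comp (@measurable_cis R).
by move=> t; rewrite lee_fin.
Qed.

(** This class contains the functions of the unit ball of [L^oo] and all polynomials, is closed
    under sums, products and conjugation, and consists of integrable functions. Every complex
    integral below stays inside it. *)
Definition ess_bounded f := cmeasurable f /\
  exists M, {ae sigma1 R, forall z, normc (f z) <= M}.

Lemma ae_bounded_integrable (h : circle R -> R) (M : R) :
  measurable_fun [set: circle R] h ->
  {ae sigma1 R, forall z, `|h z| <= M} -> (sigma1 R).-integrable setT (EFin \o h).
Proof.
move=> mh hM; apply/integrableP; split; first exact: measurableT_comp.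
have : (sigma1 R).-integrable setT (cst (Num.max M 0)%:E).
  by apply: finite_measure_integrable_cst.
move/integrableP => [_]; apply: le_lt_trans.
apply: ae_ge0_le_integral => //.
- by apply: measurableT_comp => //; exact: measurableT_comp.
- by apply: filterS hM => z hz _; rewrite /= lee_fin [leRHS]ger0_norm ?le_max ?lexx ?orbT// hz.
Qed.

Lemma ess_bounded_Re f : ess_bounded f ->
  (sigma1 R).-integrable setT (fun z => (Re (f z))%:E).
Proof.
move=> [[mr _] [M hM]]; apply: (ae_bounded_integrable (M := M) mr).
by apply: filterS hM => z; apply: le_trans; exact: ler_norm_Re.
Qed.

Lemma ess_bounded_Im f : ess_bounded f ->
  (sigma1 R).-integrable setT (fun z => (Im (f z))%:E).
Proof.
move=> [[_ mr] [M hM]]; apply: (ae_bounded_integrable (M := M) mr).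
by apply: filterS hM => z; apply: le_trans; exact: ler_norm_Im.
Qed.

Lemma ess_bounded_normc f : ess_bounded f ->
  (sigma1 R).-integrable setT (fun z => (normc (f z))%:E).
Proof.
move=> [mf [M hM]]; apply: (ae_bounded_integrable (M := M) (measurable_normc mf)).
by apply: filterS hM => z; rewrite ger0_norm ?normc_ge0.
Qed.

Lemma bounded_ess_bounded f M : cmeasurable f -> (forall z, normc (f z) <= M) ->
  ess_bounded f.
Proof. by move=> mf fM; split => //; exists M; apply/aeW. Qed.

Lemma ess_bounded_cst (a : R[i]) : ess_bounded (fun=> a).
Proof. by apply: (@bounded_ess_bounded _ (normc a)) => //; exact: cmeasurable_cst. Qed.

Lemma ess_boundedD f g : ess_bounded f -> ess_bounded g -> ess_bounded (fun z => f z + g z).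
Proof.
move=> [mf [M hM]] [mg [N hN]]; split; first exact: cmeasurableD.
exists (M + N); apply: filterS2 hM hN => z fz gz.
by rewrite (le_trans (normcD_le _ _))// lerD.
Qed.

Lemma ess_boundedM f g : ess_bounded f -> ess_bounded g -> ess_bounded (fun z => f z * g z).
Proof.
move=> [mf [M hM]] [mg [N hN]]; split; first exact: cmeasurableM.
exists (M * N); apply: filterS2 hM hN => z fz gz.
by rewrite Normc.normcM ler_pM ?normc_ge0.
Qed.

Lemma ess_bounded_conj f : ess_bounded f -> ess_bounded (fun z => (f z)^*%C).
Proof.
move=> [mf [M hM]]; split; first exact: cmeasurable_conj.
by exists M; apply: filterS hM => z; rewrite normc_conj.
Qed.

Lemma ess_bounded_circleX (k : int) : ess_bounded (fun z : circle R => val z ^ k).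
Proof.
apply: (@bounded_ess_bounded _ 1); first exact: cmeasurable_circleX.
by move=> z; rewrite normc_circleX.
Qed.

Lemma ess_bounded_sum (I : Type) (r : seq I) (P : pred I) (F : I -> circle R -> R[i]) :
  (forall i, ess_bounded (F i)) -> ess_bounded (fun z => \sum_(i <- r | P i) F i z).
Proof.
move=> bF; elim: r => [|i r ih].
  by under eq_fun do rewrite big_nil; exact: ess_bounded_cst.
under eq_fun do rewrite big_cons.
by case: (P i) => //; exact: ess_boundedD.
Qed.

Lemma cintegralD f g : ess_bounded f -> ess_bounded g ->
  cintegral (fun z => f z + g z) = cintegral f + cintegral g.
Proof.
move=> bf bg; apply/eqP; rewrite eq_complex /=.
under eq_Rintegral do rewrite reD.
rewrite RintegralD//; [|exact: ess_bounded_Re|exact: ess_bounded_Re].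
under [X in _ && (X == _)]eq_Rintegral do rewrite imD.
by rewrite RintegralD ?eqxx//; exact: ess_bounded_Im.
Qed.

Lemma cintegralZ (a : R[i]) f : ess_bounded f ->
  cintegral (fun z => a * f z) = a * cintegral f.
Proof.
move=> bf; have br := ess_bounded_Re bf; have bi := ess_bounded_Im bf.
have brZ (x : R) : (sigma1 R).-integrable setT (fun z => (x * Re (f z))%:E).
  by under eq_fun do rewrite EFinM; exact: integrableZl.
have biZ (x : R) : (sigma1 R).-integrable setT (fun z => (x * Im (f z))%:E).
  by under eq_fun do rewrite EFinM; exact: integrableZl.
apply/eqP; rewrite eq_complex; apply/andP; split; apply/eqP; rewrite ?reM ?imM /=.
  under eq_Rintegral do rewrite reM.
  by rewrite -!RintegralZl// -RintegralB//; [exact: brZ|exact: biZ].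
under eq_Rintegral do rewrite imM.
by rewrite -!RintegralZl// -RintegralD//; [exact: biZ|exact: brZ].
Qed.

Lemma cintegral_cst (a : R[i]) : cintegral (fun _ : circle R => a) = a.
Proof.
apply/eqP; rewrite eq_complex /= /Rintegral !integral_cst//= probability_setT !mule1 /=.
by rewrite !eqxx.
Qed.

Lemma cintegral_sum (I : Type) (r : seq I) (P : pred I) (F : I -> circle R -> R[i]) :
  (forall i, ess_bounded (F i)) ->
  cintegral (fun z => \sum_(i <- r | P i) F i z) = \sum_(i <- r | P i) cintegral (F i).
Proof.
move=> bF; elim: r => [|i r ih].
  by rewrite big_nil; under eq_fun do rewrite big_nil; exact: cintegral_cst.
rewrite big_cons; under eq_fun do rewrite big_cons.
case: (P i); last exact: ih.
by rewrite cintegralD ?ih//; exact: ess_bounded_sum.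
Qed.

Lemma normc_cintegral_le f : ess_bounded f ->
  normc (cintegral f) <= \int[sigma1 R]_z normc (f z).
Proof.
move=> bf; have [->|I0] := eqVneq (cintegral f) 0.
  by rewrite Normc.normc0 Rintegral_ge0// => z _; exact: normc_ge0.
set I := cintegral f in I0 *.
have nI0 : normc I != 0 by apply: contra_neq I0; exact: Normc.eq0_normc.
(* Rotation by the unimodular [u] turns the integral into its modulus, so that only real parts have
   to be compared. *)
set u := I^*%C * ((normc I)^-1)%:C%C.
have nu : normc u = 1.
  by rewrite Normc.normcM normc_conj normc_real normfV ger0_norm ?normc_ge0// mulfV.
have buf : ess_bounded (fun z => u * f z).
  by apply: ess_boundedM => //; exact: ess_bounded_cst.
have -> : normc I = Re (cintegral (fun z => u * f z)).
  rewrite cintegralZ// -/I /u mulrAC [_ * I]mulrC mulc_conj.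
  by rewrite -rmorphM /= expr2 -mulrA mulfV// mulr1.
apply: le_Rintegral => //; [exact: ess_bounded_Re|exact: ess_bounded_normc|].
move=> z _; rewrite -[leRHS]mul1r -nu -Normc.normcM.
by rewrite (le_trans (ler_norm _))// ler_norm_Re.
Qed.

(** The change of variables is available for nonnegative functions, so it is applied to [1 + c],
    nonnegative because [|c| <= 1]. The primitive [t + H t] grows by exactly [2 * pi] over a period,
    which leaves mean 1. *)
Lemma integral_period (h H : R -> R) (c : circle R -> R) :
  measurable_fun [set: circle R] c -> (forall z, `|c z| <= 1) ->
  (forall t, c (cis t) = h t) -> continuous h ->
  (forall t : R, is_derive t 1 H (h t)) -> H (2 * pi) = H 0 ->
  \int[sigma1 R]_z c z = 0.
Proof.
move=> mc c1 ch hc dH HH.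
have ic : (sigma1 R).-integrable setT (EFin \o c).
  by apply: (@ae_bounded_integrable _ 1) => //; apply/aeW.
have i1 : (sigma1 R).-integrable setT (EFin \o (cst 1 : circle R -> R)).
  by apply: finite_measure_integrable_cst.
suff : \int[sigma1 R]_z (1 + c z) = 1.
  rewrite RintegralD// Rintegral_cst// [X in fine X]probability_setT mulr1.
  by move/(congr1 (fun x => x - 1)); rewrite addrAC subrr add0r.
rewrite /Rintegral (@ge0_integral_sigma1 (fun z => 1 + c z)); last 2 first.
- exact: measurable_funD.
- by move=> z; have := c1 z; rewrite ler_norml -subr_ge0 opprK addrC => /andP[].
under eq_integral do rewrite ch.
have dH1 (t : R) : is_derive t 1 (fun s => s + H s) (1 + h t).
  by apply: is_deriveD.
rewrite (@continuous_FTC2 _ (fun t => 1 + h t) (fun t => t + H t)).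
- rewrite HH add0r -EFinB addrK -EFinM /= mulVf//.
  by rewrite gt_eqF// pi2_gt0.
- exact: pi2_gt0.
- apply: continuous_subspaceT => t; apply: continuousD; [exact: cst_continuous|exact: hc].
- have cH (t : R) : {for t, continuous (fun s => s + H s)}.
    by apply: differentiable_continuous; apply/derivable1_diffP; case: (dH1 t).
  split.
  + by move=> t _; case: (dH1 t).
  + exact: cvg_at_right_filter (cH _).
  + exact: cvg_at_left_filter (cH _).
- by move=> t _; rewrite derive1E; case: (dH1 t).
Qed.

Lemma cos_sin_2pin n : cos (n%:R * (2 * pi)) = 1 :> R /\ sin (n%:R * (2 * pi)) = 0 :> R.
Proof.
suff /eqP : val (cis (2 * pi : R)) ^+ n = 1.
  by rewrite cisX eq_complex /= => /andP[/eqP -> /eqP ->].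
rewrite [val _](_ : _ = 1) ?expr1n//.
by apply/eqP; rewrite eq_complex /= mulr_natl cos2pi sin2pi !eqxx.
Qed.

Lemma cintegral_circleX n : (0 < n)%N ->
  cintegral (fun z : circle R => val z ^+ n) = 0.
Proof.
move=> n0; have nR : n%:R != 0 :> R by rewrite pnatr_eq0 -lt0n.
have [mr mi] := @cmeasurable_circleX R n.
have e1 (z : circle R) : normc (val z ^+ n) = 1 by rewrite normcX normc_circle expr1n.
have sc : continuous (fun t : R => n%:R * t).
  by move=> s; exact: mulrl_continuous.
apply/eqP; rewrite eq_complex; apply/andP; split; apply/eqP => /=.
  apply: (@integral_period (fun t => cos (n%:R * t)) (fun t => n%:R^-1 * sin (n%:R * t))).
  - exact: mr.
  - by move=> z; rewrite -(e1 z) ler_norm_Re.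
  - by move=> t; rewrite (cisX t n).
  - by move=> t; apply: continuous_comp; [exact: sc|exact: continuous_cos].
  - move=> t; apply: is_derive_eq.
    rewrite /GRing.scale/=; field.
    done.
  - by rewrite mulr0 (cos_sin_2pin n).2 sin0.
apply: (@integral_period (fun t => sin (n%:R * t)) (fun t => - (n%:R^-1 * cos (n%:R * t)))).
- exact: mi.
- by move=> z; rewrite -(e1 z) ler_norm_Im.
- by move=> t; rewrite (cisX t n).
- by move=> t; apply: continuous_comp; [exact: sc|exact: continuous_sin].
- move=> t; apply: is_derive_eq.
  rewrite /GRing.scale/=; field.
  done.
- by rewrite mulr0 (cos_sin_2pin n).1 cos0.
Qed.

Lemma cintegral_circleXz (k : int) :
  cintegral (fun z : circle R => val z ^ k) = (k == 0)%:R.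
Proof.
case: k => [[|n]|n].
- by rewrite eqxx; under eq_fun do rewrite expr0z; exact: cintegral_cst.
- exact: (@cintegral_circleX n.+1).
have bX := @ess_bounded_circleX n.+1.
have r0 : Re (cintegral (fun z : circle R => val z ^+ n.+1)) = 0.
  by rewrite cintegral_circleX.
have i0 : Im (cintegral (fun z : circle R => val z ^+ n.+1)) = 0.
  by rewrite cintegral_circleX.
have nE (z : circle R) : val z ^ Negz n = (val z ^+ n.+1)^*%C.
  by rewrite NegzE -exprnN -exprVn circleV rmorphXn.
apply/eqP; rewrite eq_complex /=; apply/andP; split; apply/eqP.
  rewrite -[RHS]r0; apply: eq_Rintegral => z _; rewrite nE.
  by case: (_ ^+ _).
transitivity (- Im (cintegral (fun z : circle R => val z ^+ n.+1))); last by rewrite i0 oppr0.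
rewrite /= -mulN1r -RintegralZl//; last exact: (ess_bounded_Im bX).
by apply: eq_Rintegral => z _; rewrite nE mulN1r; case: (_ ^+ _).
Qed.

Lemma cmeasurable_horner (p : {poly R[i]}) : cmeasurable (fun z : circle R => p.[val z]).
Proof.
under eq_fun do rewrite horner_coef.
apply: cmeasurable_sum => i; apply: cmeasurableM; first exact: cmeasurable_cst.
exact: cmeasurableX cmeasurable_val.
Qed.

Lemma horner_circle_bound (p : {poly R[i]}) : 
  exists M : R, forall z : circle R, normc p.[val z] <= M.
Proof.
exists (\sum_(i < size p) normc p`_i) => z.
rewrite horner_coef (le_trans (normc_sum_le _ _ _))// ler_sum// => i _.
by rewrite Normc.normcM normcX normc_circle expr1n mulr1.
Qed.

Lemma ess_bounded_horner (p : {poly R[i]}) : ess_bounded (fun z : circle R => p.[val z]).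
Proof.
have [M hM] := horner_circle_bound p.
exact: bounded_ess_bounded (cmeasurable_horner p) hM.
Qed.

(** The mean value property at the origin, in the only case that the upper bound uses. *)
Lemma cintegral_horner (p : {poly R[i]}) :
  cintegral (fun z : circle R => p.[val z]) = p.[0].
Proof.
have bX (i : nat) : ess_bounded (fun z : circle R => val z ^+ i) by exact: (ess_bounded_circleX i).
under eq_fun do rewrite horner_coef.
rewrite cintegral_sum; last first.
  by move=> i; apply: ess_boundedM => //; exact: ess_bounded_cst.
rewrite horner_coef; apply: eq_bigr => i _.
rewrite cintegralZ//; congr (_ * _).
by case: i => -[|i] /= _; [exact: cintegral_cst|rewrite expr0n; exact: cintegral_circleX].
Qed.

End CircleIntegral.

(** * Exponential bound for trigonometric polynomials *)

Section ComplexExponential.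
Context {R : realType}.
Implicit Types (x y t : R) (z w : R[i]).

Lemma is_derive_continuous (f df : R -> R) :
  (forall t : R, is_derive t 1 f (df t)) -> continuous f.
Proof.
by move=> fd t; apply: differentiable_continuous; apply/derivable1_diffP; case: (fd t).
Qed.

Lemma MVT_norm_le (f df : R -> R) (K y : R) :
  (forall t : R, is_derive t 1 f (df t)) ->
  (forall t, `|t| <= `|y| -> `|df t| <= K) -> `|f y - f 0| <= K * `|y|.
Proof.
move=> fd fK.
have cf (A : set R) : {within A, continuous f}.
  by apply: continuous_subspaceT; exact: is_derive_continuous fd.
have [y0|/ltW y0] := leP 0 y.
  have [c] := MVT_segment y0 (fun t _ => fd t) (cf _).
  rewrite in_itv/= => /andP[c0 cy] ->.
  rewrite subr0 normrM ler_wpM2r// fK//.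
  by rewrite !ger0_norm.
have [c] := MVT_segment y0 (fun t _ => fd t) (cf _).
rewrite in_itv/= => /andP[c0 cy]; rewrite distrC => ->.
rewrite sub0r normrM normrN ler_wpM2r// fK//.
by rewrite !ler0_norm// lerN2.
Qed.

Lemma norm_sin_le y : `|sin y| <= `|y|.
Proof.
have := @MVT_norm_le sin cos 1 y (fun t => is_derive_sin t) (fun t _ => cos_max t).
by rewrite sin0 subr0 mul1r.
Qed.

Lemma one_sub_cos_le y : 1 - cos y <= y ^+ 2 / 2.
Proof.
have -> : cos y = cos (y / 2 + y / 2) by rewrite -splitr.
rewrite cosD; have := cos2Dsin2 (y / 2).
have := norm_sin_le (y / 2); rewrite -ler_sqr ?nnegrE// !real_normK ?num_real//.
nra.
Qed.

Lemma norm_sin_sub_le y : `|y| <= 1 -> `|sin y - y| <= y ^+ 2.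
Proof.
move=> y1.
have h : `|sin y - y| <= `|y| ^+ 2 / 2 * `|y|.
  have := @MVT_norm_le (fun t => sin t - t) (fun t => cos t - 1) (`|y| ^+ 2 / 2) y.
  rewrite sin0 !subr0; apply => t ty.
  rewrite distrC ger0_norm ?subr_ge0 ?cos_le1//.
  rewrite (le_trans (one_sub_cos_le t))// ler_wpM2r ?invr_ge0//.
  by rewrite -[t ^+ 2]real_normK ?num_real// ler_sqr ?nnegrE.
rewrite (le_trans h)// -[y ^+ 2]real_normK ?num_real//.
by have := normr_ge0 y; nra.
Qed.

Lemma expR_sub_1D_le x : `|x| <= 2^-1 -> `|expR x - 1 - x| <= 2 * x ^+ 2.
Proof.
move=> hx.
have h1 : 0 <= expR x - 1 - x by have := expR_ge1Dx x; lra.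
rewrite ger0_norm//.
have h2 := expR_ge1Dx (- x).
have e0 := expR_gt0 x.
(* This is [exp (- x) >= 1 - x]. It gives [exp x <= 1 / (1 - x)], which exceeds [1 + x] by
   [x^2 / (1 - x) <= 2 x^2]. *)
have h3 : expR x * (1 - x) <= 1.
  rewrite -[leRHS](mulfV (lt0r_neq0 e0)) ler_pM2l// -expRN//.
move: hx; rewrite ler_norml => /andP[xl xr].
nra.
Qed.

Definition cexp z : R[i] := Complex (expR (Re z) * cos (Im z)) (expR (Re z) * sin (Im z)).

Lemma cexpD z w : cexp (z + w) = cexp z * cexp w.
Proof.
apply/eqP; rewrite eq_complex reM imM /= reD imD cosD sinD expRD.
by apply/andP; split; apply/eqP; ring.
Qed.

Lemma cexp0 : cexp 0 = 1.
Proof. by rewrite /cexp /= expR0 cos0 sin0 mulr1 mulr0. Qed.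

Lemma cexpMn z n : cexp (z *+ n) = cexp z ^+ n.
Proof. by elim: n => [|n ih]; rewrite ?cexp0// mulrS cexpD ih exprS. Qed.

Lemma normc_cexp z : normc (cexp z) = expR (Re z).
Proof.
apply/eqP; rewrite -(@eqrXn2 _ 2) ?normc_ge0 ?expR_ge0// normc_sqrE /=.
by rewrite !exprMn -mulrDr cos2Dsin2 mulr1.
Qed.

Lemma cexp_sub_1D_le z : normc z <= 2^-1 ->
  normc (cexp z - (1 + z)) <= 4 * normc z ^+ 2.
Proof.
move=> hz; rewrite normc_sqrE; apply: (le_trans (normc_le_ReIm _)).
have hx := le_trans (ler_norm_Re z) hz; have hy := le_trans (ler_norm_Im z) hz.
case: z {hz} hx hy => x y /= hx hy; rewrite add0r.
have ex := expR_sub_1D_le hx.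
have sy : `|sin y - y| <= y ^+ 2 by apply: norm_sin_sub_le; lra.
have s1 := norm_sin_le y.
have c1 := one_sub_cos_le y.
have c2 : `|cos y| <= 1 := cos_max y.
have c3 := cos_le1 y.
have hre : `|expR x * cos y - (1 + x)| <= 2 * (x ^+ 2 + y ^+ 2).
  rewrite (_ : _ - _ = (expR x - 1 - x) * cos y + (1 + x) * (cos y - 1)); last by ring.
  rewrite (le_trans (ler_normD _ _))// !normrM.
  have a1 : `|expR x - 1 - x| * `|cos y| <= 2 * x ^+ 2 * 1 by exact: ler_pM.
  have a2 : `|1 + x| <= 2 by rewrite (le_trans (ler_normD _ _))// normr1; lra.
  have a3 : `|cos y - 1| <= y ^+ 2 / 2 by rewrite distrC ger0_norm// subr_ge0.
  have := ler_pM (normr_ge0 _) (normr_ge0 _) a2 a3.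
  lra.
have him : `|expR x * sin y - y| <= 2 * (x ^+ 2 + y ^+ 2).
  rewrite (_ : _ - _ = (expR x - 1) * sin y + (sin y - y)); last by ring.
  rewrite (le_trans (ler_normD _ _))// normrM.
  have a2 : `|expR x - 1| <= 2 * `|x|.
    rewrite (_ : _ - _ = (expR x - 1 - x) + x); last by ring.
    rewrite (le_trans (ler_normD _ _))//.
    move: ex; rewrite -[x ^+ 2]real_normK ?num_real//; have := normr_ge0 x; nra.
  have := ler_pM (normr_ge0 _) (normr_ge0 _) a2 s1.
  have -> : x ^+ 2 = `|x| ^+ 2 by rewrite real_normK ?num_real.
  have := sy; rewrite -[y ^+ 2]real_normK ?num_real//.
  have := normr_ge0 x; have := normr_ge0 y; nra.
lra.
Qed.

Lemma normc_subXX_le (a b : R[i]) (M : R) n : normc a <= M -> normc b <= M -> 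
  normc (a ^+ n - b ^+ n) <= n%:R * M ^+ n.-1 * normc (a - b).
Proof.
move=> aM bM; rewrite subrXX Normc.normcM mulrC ler_wpM2r ?normc_ge0//.
rewrite (le_trans (normc_sum_le _ _ _))//.
rewrite (_ : _ * M ^+ _ = \sum_(i < n) M ^+ n.-1); last by rewrite sumr_const card_ord mulr_natl.
rewrite ler_sum// => i _.
rewrite Normc.normcM !normcX.
have M0 : 0 <= M by exact: le_trans (normc_ge0 _) aM.
have -> : M ^+ n.-1 = M ^+ (n.-1 - i) * M ^+ i.
  by rewrite -exprD subnK// -ltnS prednK// (leq_ltn_trans _ (ltn_ord i)).
by apply: ler_pM; rewrite ?exprn_ge0 ?normc_ge0// lerXn2r ?nnegrE ?normc_ge0.
Qed.

(** Euler's limit with a rate uniform on bounded sets. With [a = exp (w / n)] and [b = 1 + w / n],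
    both of modulus at most [exp (|w| / n)], the difference [a^n - b^n] costs a factor [n] while
    [a - b] is of order [1 / n^2]. *)
Lemma cexp_approx w n : (0 < n)%N -> normc w <= n%:R / 2 ->
  normc (cexp w - (1 + w / n%:R) ^+ n) <= 4 * normc w ^+ 2 * expR (normc w) / n%:R.
Proof.
move=> n0 wn; have nR : 0 < n%:R :> R by rewrite ltr0n.
set u := w / n%:R.
have uE : normc u = normc w / n%:R.
  rewrite Normc.normcM Normc.normcV; congr (_ / _).
  by rewrite -(rmorph_nat (@real_complex R)) normc_real ger0_norm ?ler0n.
have wE : w = u *+ n.
  by rewrite -mulr_natr mulfVK// pnatr_eq0 -lt0n.
have u2 : normc u <= 2^-1 by rewrite uE ler_pdivrMr// mulrC.
rewrite {1}wE cexpMn.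
have := @normc_subXX_le (cexp u) (1 + u) (expR (normc u)) n _ _.
rewrite normc_cexp ler_expR (le_trans (ler_norm _) (ler_norm_Re u)) => /(_ isT).
have -> : normc (1 + u) <= expR (normc u).
  by rewrite (le_trans (normcD_le _ _))// Normc.normc1 expR_ge1Dx.
move=> /(_ isT) h; apply: (le_trans h).
have -> : 4 * normc w ^+ 2 * expR (normc w) / n%:R = 
   n%:R * expR (normc w) * (4 * normc u ^+ 2).
  by rewrite uE; field; rewrite gt_eqF.
apply: ler_pM; rewrite ?normc_ge0 ?mulr_ge0 ?exprn_ge0 ?expR_ge0//; last exact: cexp_sub_1D_le.
rewrite ler_pM2l// -expRM_natl ler_expR uE.
rewrite mulrCA ler_piMr ?normc_ge0//.
by rewrite ler_pdivrMr// mul1r ler_nat leq_pred.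
Qed.

End ComplexExponential.

(** * Trigonometric polynomials [F + G^*] bounded by 1 *)

Section TrigonometricPolynomial.
Context {R : realType}.
Implicit Types (x y r : R) (z w : R[i]).

(* Hence [((1 + w) ^ n + (1 - w) ^ n) / 2], which approximates [cosh (n w)], is a
   polynomial in [w ^ 2]. *)
Lemma exprn_even_odd n : exists A B : {poly R[i]}, forall w : R[i],
  (1 + w) ^+ n = A.[w ^+ 2] + w * B.[w ^+ 2] /\
  (1 - w) ^+ n = A.[w ^+ 2] - w * B.[w ^+ 2].
Proof.
elim: n => [|n [A [B AB]]].
  by exists 1, 0 => w; rewrite !expr0 !hornerE ?mulr0 ?addr0 ?subr0.
exists (A + 'X * B), (A + B) => w; have [h1 h2] := AB w.
by split; rewrite exprS ?h1 ?h2 !hornerE; ring.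
Qed.

(* With [f := F + G^*], [w ^ 2 = `|F| ^ 2 - F * f^*] lies inside the parabola
   [Im (w ^ 2) ^ 2 = Re (w ^ 2) + 1 / 4], the image of the lines [Im w = +- 1 / 2]
   under squaring. *)
Lemma parabola_bounds (F G w : R[i]) :
  normc (F + G^*%C) <= 1 -> w ^+ 2 = - (F * G) ->
  `|Im w| <= 2^-1 /\ normc F - 1 <= `|Re w|.
Proof.
set f := F + _ => f1 wE.
have r0 := normc_ge0 F; have rE := normc_sqrE F.
have f2 : normc f ^+ 2 <= 1 by rewrite exprn_ile1// normc_ge0.
(* [a + i b] is [F * f^*], of modulus at most [|F|] because [|f| <= 1]. From here on only real
   algebra in [x], [y], [r], [a], [b] remains. *)
have [a [b [ab xy xy2]]] : exists a b, [/\ a ^+ 2 + b ^+ 2 <= normc F ^+ 2,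
    Re w ^+ 2 - Im w ^+ 2 = normc F ^+ 2 - a & 2 * Re w * Im w = - b].
  exists (Re (F * f^*%C)), (Im (F * f^*%C)); split.
  - by rewrite -normc_sqrE Normc.normcM normc_conj exprMn ler_piMr// sqr_ge0.
  - rewrite rE; move/(congr1 (@complex.Re R)) : wE; rewrite /f expr2.
    case: (F) => F1 F2; case: (G) => G1 G2; case: (w) => x y /=; lra.
  - move/(congr1 (@complex.Im R)) : wE; rewrite /f expr2.
    case: (F) => F1 F2; case: (G) => G1 G2; case: (w) => x y /=; lra.
have -> : (`|Im w| <= 2^-1) = (Im w ^+ 2 <= 4^-1).
  rewrite -ler_sqr ?nnegrE// real_normK ?num_real//; congr (_ <= _); by field.
move: (Re w) (Im w) (normc F) r0 ab xy xy2 => x y r r0 ab xy xy2 {rE f2 f1 wE}.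
have ar : a <= r.
  have : `|a| <= r by rewrite -ler_sqr ?nnegrE// real_normK ?num_real//; have := sqr_ge0 b; lra.
  exact: le_trans (ler_norm _).
(* The left side is [x^2 y^2 = b^2 / 4]. *)
have key : y ^+ 2 * (y ^+ 2 + r ^+ 2 - a) <= (r ^+ 2 - a ^+ 2) / 4.
  have -> : y ^+ 2 + r ^+ 2 - a = x ^+ 2 by lra.
  have : (2 * x * y) ^+ 2 = b ^+ 2 by rewrite xy2 sqrrN.
  nra.
have y4 : y ^+ 2 <= 4^-1.
  move: (y ^+ 2) (sqr_ge0 y) key => Y Y0 key.
  (* By [key], [(Y - 1/4) (Y + r^2 - a + 1/4)] is at most [- (a - 1/2)^2 / 4]. For [Y > 1/4] both
     factors would be positive, the second because [a <= r] gives [r^2 - a + 1/4 >= (r - 1/2)^2]. *)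
  rewrite leNgt; apply/negP => Y4.
  have K0 : 0 <= r ^+ 2 - a + 4^-1 by have := sqr_ge0 (r - 2^-1); nra.
  have := sqr_ge0 (2^-1 - a); have : 0 < (Y - 4^-1) * (Y + (r ^+ 2 - a + 4^-1)).
    by rewrite mulr_gt0//; lra.
  nra.
split => //.
(* For [r > 1]: [x^2 >= r^2 - a >= r^2 - r >= (r - 1)^2]. *)
have [r1|r1] := leP r 1; first by rewrite (le_trans _ (normr_ge0 _))// subr_le0.
rewrite -ler_sqr ?nnegrE//; last by rewrite subr_ge0 ltW.
rewrite real_normK ?num_real//; have := sqr_ge0 y; nra.
Qed.

(** Here [c < pi] enters: [|c Im w| <= c / 2 < pi / 2] keeps the cosine factor above the positive
    number [cos (c / 2)]. The bound is the same for both square roots [w]. *)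
Lemma Re_cosh_ge (c : R) (F G w : R[i]) : 0 < c -> c < pi ->
  normc (F + G^*%C) <= 1 -> w ^+ 2 = - (F * G) ->
  cos (c / 2) / 2 * expR (c * (normc F - 1)) <=
  Re (cexp ((c%:C)%C * w) + cexp (- ((c%:C)%C * w))) / 2.
Proof.
move=> c0 cpi f1 wE; have [yb xb] := parabola_bounds f1 wE.
rewrite reD /=.
case: w yb xb {wE} => x y /= yb xb.
rewrite !mul0r !subr0 !addr0 cosN -mulrDl.
have cy : cos (c / 2) <= cos (c * y).
  have -> : cos (c * y) = cos (c * `|y|).
    by case: (ger0P y) => // _; rewrite mulrN cosN.
  have [->//|/eqP yn] := eqVneq (c * `|y|) (c / 2).
  rewrite le_eqVlt; apply/orP; right.
  have p0 : 0 < pi :> R by exact: pi_gt0.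
  rewrite ltr_cos ?in_itv/=.
  - by rewrite lt_neqAle; apply/andP; split; [exact/eqP|rewrite ler_pM2l].
  - by apply/andP; split; [rewrite mulr_ge0// ltW|have := normr_ge0 y; nra].
  - by apply/andP; split; lra.
have c2 : 0 < cos (c / 2) by apply: cos_gt0_pihalf; have := pi_gt0 R; lra.
have ex : expR (c * (normc F - 1)) <= expR (c * x) + expR (- (c * x)).
  have h : expR (c * (normc F - 1)) <= expR (c * `|x|).
    by rewrite ler_expR ler_pM2l.
  apply: (le_trans h); case: (ger0P x) => _; first by rewrite lerDl expR_ge0.
  by rewrite mulrN lerDr expR_ge0.
rewrite mulrAC ler_wpM2r// mulrC ler_pM ?expR_ge0// ltW//.
Qed.

Lemma integral_expR_trig_le (c : R) (F G : {poly R[i]}) : 0 < c -> c < pi ->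
  G.[0] = 0 -> (forall z : circle R, normc (F.[val z] + (G.[val z])^*%C) <= 1) ->
  \int[sigma1 R]_z expR (c * normc F.[val z]) <= 2 * expR c / cos (c / 2).
Proof.
move=> c0 cpi G0 FG1.
have c2 : 0 < cos (c / 2) by apply: cos_gt0_pihalf; have := pi_gt0 R; lra.
(* [B] bounds [|c w|] on the circle when [w^2 = - F G]: either [|w| <= 1], or
   [|w| <= |w|^2 <= BF * BG]. [D] is then the constant of [cexp_approx] for [|c w| <= B]. *)
have [BF hBF] := horner_circle_bound F; have [BG hBG] := horner_circle_bound G.
pose B := c * Num.max 1 (BF * BG).
pose D := 4 * B ^+ 2 * expR B.
have B0 : 0 <= B by rewrite mulr_ge0 ?ltW// lt_max ltr01.
have D0 : 0 <= D by rewrite mulr_ge0 ?expR_ge0// mulr_ge0// sqr_ge0.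
pose k := cos (c / 2) / 2 * expR (- c).
have k0 : 0 < k by rewrite mulr_gt0 ?expR_gt0// divr_gt0.
have iF : (sigma1 R).-integrable setT (fun z : circle R => (expR (c * normc F.[val z]))%:E).
  apply: (@ae_bounded_integrable _ _ (expR (c * BF))).
    apply: measurableT_comp => //; apply: measurable_funM => //.
    by apply: measurable_normc; exact: cmeasurable_horner.
  apply/aeW => z; rewrite ger0_norm ?expR_ge0// ler_expR ler_pM2l//.
(* The hyperbolic cosine is replaced by a polynomial at the price [D / n], with [n] arbitrarily
   large. The condition [B <= n / 2] is the range of [cexp_approx], and [1 / k] is the announced
   constant. *)
suff H n : (0 < n)%N -> B <= n%:R / 2 ->
    k * \int[sigma1 R]_z expR (c * normc F.[val z]) <= 1 + D / n%:R.
  have : k * \int[sigma1 R]_z expR (c * normc F.[val z]) <= 1.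
    apply/ler_addgt0Pr => e e0.
    have De : 0 <= D / e := divr_ge0 D0 (ltW e0).
    have DB0 : 0 <= D / e + 2 * B := addr_ge0 De (mulr_ge0 (ler0n _ _) B0).
    have := archi_boundP DB0; set n := Num.bound _ => nDB.
    have n0 : 0 < n%:R :> R by exact: le_lt_trans nDB.
    have aux (x b y : R) : 0 <= x -> 0 <= b -> x + 2 * b < y -> b <= y / 2 /\ x <= y.
      by clear; move=> *; split; lra.
    have [Bn Dn] := aux _ _ _ De B0 nDB.
    apply: le_trans (H n _ _) _; [by rewrite -(@ltr0n R)|by []|].
    by rewrite lerD2l ler_pdivrMr// mulrC -ler_pdivrMr.
  rewrite mulrC -ler_pdivlMr// => /le_trans; apply.
  rewrite le_eqVlt; apply/orP; left; apply/eqP; rewrite /k expRN; field.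
  by rewrite !gt_eqF ?expR_gt0.
move=> n0 Bn; have nR : 0 < n%:R :> R by rewrite ltr0n.
have [P [Q PQ]] := exprn_even_odd n.
pose u : R[i] := (c%:C)%C / n%:R.
(* On the circle [T] equals [((1 + c w / n)^n + (1 - c w / n)^n) / 2], because the odd part [Q]
   cancels. Its value at 0 is 1 because [G.[0] = 0]. *)
pose T := P \Po ((u ^+ 2) *: - (F * G)).
have T0 : T.[0] = 1.
  rewrite horner_comp hornerZ hornerN hornerM G0 mulr0 oppr0 mulr0.
  by have [+ _] := PQ 0; rewrite expr0n /= mul0r !addr0 expr1n => <-.
have bT := ess_bounded_horner T.
have TI : Re (cintegral (fun z : circle R => T.[val z])) = 1.
  by rewrite cintegral_horner T0.
rewrite -[X in _ <= X + _]TI /= -RintegralZl//.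
have -> : D / n%:R = \int[sigma1 R]_z (cst (D / n%:R) z).
  by rewrite Rintegral_cst// [X in fine X]probability_setT mulr1.
have iD : (sigma1 R).-integrable setT (EFin \o (cst (D / n%:R) : circle R -> R)).
  by apply: finite_measure_integrable_cst.
rewrite -RintegralD//; last exact: ess_bounded_Re.
apply: le_Rintegral => //.
- exact: (@integrableZl _ _ _ (sigma1 R) setT _ k _ iF).
- exact: (@integrableD _ _ _ (sigma1 R) setT _ _ _ (ess_bounded_Re bT) iD).
move=> z _; set Fz := F.[val z]; set Gz := G.[val z].
(* The root is chosen separately at each point. Since [T] depends on [w^2] alone, the choice leaves
   no trace in the integrand. *)
pose w := sqrtC (- (Fz * Gz)).
have wE : w ^+ 2 = - (Fz * Gz) by rewrite sqrtCK.
have := Re_cosh_ge c0 cpi (FG1 z) wE; rewrite -/Fz -/Gz.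
rewrite mulrBr mulr1 expRD mulrA mulrAC -/k => /le_trans; apply.
have wB : normc w ^+ 2 <= BF * BG.
  by rewrite -normcX wE normcNE Normc.normcM ler_pM ?normc_ge0 ?hBF ?hBG.
have cwB : normc ((c%:C)%C * w) <= B.
  rewrite Normc.normcM normc_real gtr0_norm// ler_pM2l// le_max.
  have [//|w1 /=] := leP (normc w) 1.
  by rewrite (le_trans _ wB)// expr2 ler_peMl ?normc_ge0// ltW.
have app (v : R[i]) : normc v <= B -> normc (cexp v - (1 + v / n%:R) ^+ n) <= D / n%:R.
  move=> vB; rewrite (le_trans (cexp_approx n0 (le_trans vB Bn)))//.
  rewrite ler_pM2r ?invr_gt0// /D; apply: ler_pM; rewrite ?expR_ge0 ?ler_expR//.
    by rewrite mulr_ge0// sqr_ge0.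
  by rewrite ler_pM2l// ler_sqr ?nnegrE ?normc_ge0.
have a1 := app _ cwB.
have := app (- ((c%:C)%C * w)); rewrite normcNE => /(_ cwB) a2.
have TE : T.[val z] + T.[val z] = (1 + (c%:C)%C * w / n%:R) ^+ n + (1 + - ((c%:C)%C * w) / n%:R) ^+ n.
  have [h1 h2] := PQ (u * w).
  have -> : (c%:C)%C * w / n%:R = u * w by rewrite mulrAC.
  have -> : - ((c%:C)%C * w) / n%:R = - (u * w) by rewrite mulNr mulrAC.
  rewrite h1 h2 addrACA subrr addr0 horner_comp hornerZ hornerN hornerM -/Fz -/Gz.
  have <- : (u * w) ^+ 2 = u ^+ 2 * - (Fz * Gz) by rewrite -wE; ring.
  done.
have TR := congr1 (@complex.Re R) TE.
have r1 := le_trans (ler_norm _) (le_trans (ler_norm_Re _) a1).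
have r2 := le_trans (ler_norm _) (le_trans (ler_norm_Re _) a2).
rewrite !(reD, reN) in r1 r2 TR *.
have aux (x y x' y' s d : R) : x - x' <= d -> y - y' <= d -> s + s = x' + y' ->
    (x + y) / 2 <= s + d.
  by clear; lra.
exact: aux r1 r2 TR.
Qed.

End TrigonometricPolynomial.

(** * Exponential bound for bounded functions *)

Section Fejer.
Context {R : realType}.
Implicit Types (f g h : circle R -> R[i]).

(** Enlarging the square from [n] to [n + 1] adds a row with the differences [0, ..., n] and a
    column with [-1, ..., -n]. This splits a Fejer sum into its analytic and its anti-analytic
    half. *)
Lemma sum_int_diff (V : zmodType) (a : int -> V) n :
  \sum_(i < n) \sum_(j < n) a (i%:Z - j%:Z) =
  \sum_(i < n) \sum_(k < i.+1) a k%:Z + \sum_(i < n) \sum_(k < i) a (- (k.+1)%:Z).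
Proof.
elim: n => [|n ih]; first by rewrite !big_ord0 addr0.
have hD : \sum_(j < n.+1) a (n%:Z - j%:Z) = \sum_(k < n.+1) a k%:Z.
  rewrite (reindex_inj rev_ord_inj) /=; apply: eq_bigr => i _.
  by congr a; rewrite subSS subzn ?leq_subr// subKn// -ltnS.
have hC : \sum_(i < n) a (i%:Z - n%:Z) = \sum_(k < n) a (- (k.+1)%:Z).
  rewrite (reindex_inj rev_ord_inj) /=; apply: eq_bigr => i _.
  by congr a; have := ltn_ord i; lia.
rewrite [LHS]big_ord_recr /= hD; under eq_bigr do rewrite big_ord_recr /=.
rewrite big_split /= ih hC [X in _ = X + _]big_ord_recr [X in _ = _ + X]big_ord_recr /=.
by rewrite -!addrA; congr (_ + _); rewrite addrA addrC.
Qed.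

Definition fejer_pos f n : {poly R[i]} :=
  (n%:R^-1) *: \sum_(i < n) \sum_(k < i.+1) fourier_coef f k%:Z *: 'X^k.

(** The coefficients are conjugated so that the negative frequencies of the Fejer mean become [G^*]
    with [G] a polynomial vanishing at 0, the form that [integral_expR_trig_le] takes. *)
Definition fejer_neg f n : {poly R[i]} :=
  (n%:R^-1) *: \sum_(i < n) \sum_(k < i) (fourier_coef f (- (k.+1)%:Z))^*%C *: 'X^(k.+1).

Lemma fejer_neg0 f n : (fejer_neg f n).[0] = 0.
Proof.
rewrite hornerZ horner_sum big1 ?mulr0// => i _.
rewrite horner_sum big1// => k _.
by rewrite hornerZ hornerXn expr0n mulr0.
Qed.

Lemma fejer_pos_mean f n (z : circle R) :
  (fejer_pos f n).[val z] = n%:R^-1 * \sum_(i < n) riesz_partial f i.+1 z.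
Proof.
rewrite hornerZ horner_sum; congr (_ * _); apply: eq_bigr => i _.
rewrite horner_sum /riesz_partial big_mkord; apply: eq_bigr => k _.
by rewrite hornerZ hornerXn.
Qed.

Lemma conjc_natV n : ((n%:R : R[i])^-1)^*%C = n%:R^-1.
Proof. by rewrite fmorphV rmorph_nat. Qed.

Lemma fejer_sum f n (z : circle R) :
  (fejer_pos f n).[val z] + ((fejer_neg f n).[val z])^*%C =
  n%:R^-1 * \sum_(i < n) \sum_(j < n)
    fourier_coef f (i%:Z - j%:Z) * val z ^ (i%:Z - j%:Z).
Proof.
rewrite (sum_int_diff (fun k => fourier_coef f k * val z ^ k)) /fejer_pos /fejer_neg.
move: (fourier_coef f) => a.
rewrite !hornerZ rmorphM /= conjc_natV -mulrDr; congr (_ * (_ + _)).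
  rewrite horner_sum; apply: eq_bigr => i _; rewrite horner_sum; apply: eq_bigr => k _.
  by rewrite hornerZ hornerXn.
rewrite horner_sum rmorph_sum; apply: eq_bigr => i _.
rewrite horner_sum rmorph_sum; apply: eq_bigr => k _.
rewrite hornerZ hornerXn [LHS]rmorphM; congr (_ * _); first exact: conjcK.
by rewrite [LHS]rmorphXn -[X in X ^+ _]circleV exprVn exprnN.
Qed.

Lemma fejer_kernel n (u : R[i]) : u != 0 -> u^-1 = u^*%C ->
  \sum_(i < n) \sum_(j < n) u ^ (i%:Z - j%:Z) =
  ((normc (\sum_(i < n) u ^+ i) ^+ 2)%:C)%C.
Proof.
move=> u0 uV; rewrite -mulc_conj rmorph_sum mulr_suml; apply: eq_bigr => i _.
rewrite mulr_sumr; apply: eq_bigr => j _.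
by rewrite expfzDr// -exprnN -exprVn uV rmorphXn.
Qed.

Lemma ae_le_Rintegral (a b : circle R -> R) :
  (sigma1 R).-integrable setT (EFin \o a) -> (sigma1 R).-integrable setT (EFin \o b) ->
  (forall z, 0 <= a z) -> (forall z, 0 <= b z) ->
  {ae sigma1 R, forall z, a z <= b z} ->
  \int[sigma1 R]_z a z <= \int[sigma1 R]_z b z.
Proof.
move=> ia ib a0 b0 ab; apply: fine_le; [exact: integrable_fin_num|exact: integrable_fin_num|].
apply: ae_ge0_le_integral => //.
- by move=> z _; rewrite lee_fin.
- by case/integrableP : ia.
- by move=> z _; rewrite lee_fin.
- by case/integrableP : ib.
- by apply: filterS ab => z h _; rewrite lee_fin.
Qed.

Lemma fejer_le1 f n (z : circle R) : cmeasurable f ->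
  {ae sigma1 R, forall w, normc (f w) <= 1} ->
  normc ((fejer_pos f n).[val z] + ((fejer_neg f n).[val z])^*%C) <= 1.
Proof.
move=> mf f1; have bf : ess_bounded f by split => //; exists 1.
have [->|n0] := posnP n.
  by rewrite fejer_sum big_ord0 mulr0 Normc.normc0.
have nR : n%:R != 0 :> R by rewrite pnatr_eq0 -lt0n.
have nC : n%:R != 0 :> R[i] by rewrite pnatr_eq0 -lt0n.
(* The Fejer kernel centred at [z]. It is nonnegative ([KE]) and of mean 1 ([KI]), so convolution
   with it does not increase the supremum. *)
pose K (w : circle R) : R[i] := n%:R^-1 * \sum_(i < n) \sum_(j < n)
  (val z ^ (i%:Z - j%:Z) * val w ^ (- (i%:Z - j%:Z))).
have bK1 (k : int) : ess_bounded (fun w : circle R => val z ^ k * val w ^ (- k)).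
  by apply: ess_boundedM; [exact: ess_bounded_cst|exact: ess_bounded_circleX].
have bKi (i : 'I_n) : ess_bounded (fun w : circle R => \sum_(j < n)
  (val z ^ (i%:Z - j%:Z) * val w ^ (- (i%:Z - j%:Z)))).
  by apply: ess_bounded_sum => j; exact: bK1.
have bKs : ess_bounded (fun w : circle R => \sum_(i < n) \sum_(j < n)
  (val z ^ (i%:Z - j%:Z) * val w ^ (- (i%:Z - j%:Z)))).
  by apply: ess_bounded_sum => i; exact: bKi.
have bK : ess_bounded K by apply: ess_boundedM => //; exact: ess_bounded_cst.
have -> : (fejer_pos f n).[val z] + ((fejer_neg f n).[val z])^*%C =
    cintegral (fun w => f w * K w).
  rewrite fejer_sum /K.
  under [in RHS]eq_fun do rewrite mulrCA.
  rewrite cintegralZ; last exact: ess_boundedM.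
  congr (_ * _).
  under [in RHS]eq_fun do rewrite mulr_sumr.
  rewrite cintegral_sum; last by move=> i; exact: ess_boundedM.
  apply: eq_bigr => i _.
  under [in RHS]eq_fun do rewrite mulr_sumr.
  rewrite cintegral_sum; last by move=> j; exact: ess_boundedM.
  apply: eq_bigr => j _.
  under [in RHS]eq_fun do rewrite mulrCA.
  rewrite (cintegralZ _ (ess_boundedM bf (ess_bounded_circleX _))).
  by rewrite mulrC.
have KE w : K w = ((normc (K w))%:C)%C.
  rewrite /K.
  have -> : \sum_(i < n) \sum_(j < n) (val z ^ (i%:Z - j%:Z) * val w ^ (- (i%:Z - j%:Z))) =
    \sum_(i < n) \sum_(j < n) (val z / val w) ^ (i%:Z - j%:Z).
    by apply: eq_bigr => i _; apply: eq_bigr => j _; rewrite expfzMl exprz_inv.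
  rewrite fejer_kernel; last 2 first.
    by rewrite mulf_neq0 ?invr_eq0 ?circle_neq0.
    by apply: invc_conj; rewrite Normc.normcM Normc.normcV !normc_circle invr1 mulr1.
  rewrite -(rmorph_nat (@real_complex R)) -fmorphV -rmorphM normc_real ger0_norm//.
  by rewrite mulr_ge0 ?invr_ge0 ?ler0n ?sqr_ge0.
(* Only the [n] diagonal terms [i = j] have nonzero mean. *)
have KI : \int[sigma1 R]_w normc (K w) = 1.
  transitivity (Re (cintegral K)).
    by apply: eq_Rintegral => w _; rewrite {2}KE.
  rewrite /K cintegralZ// cintegral_sum//.
  rewrite (eq_bigr (fun=> 1)); last first.
    move=> i _; rewrite cintegral_sum; last by move=> j; exact: bK1.
    rewrite (bigD1 i)//= subrr cintegralZ; last exact: ess_bounded_circleX.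
    rewrite cintegral_circleXz oppr0 eqxx mulr1 expr0z big1 ?addr0// => j ji.
    rewrite cintegralZ; last exact: ess_bounded_circleX.
    rewrite cintegral_circleXz oppr_eq0 subr_eq0 eqz_nat.
    by rewrite (_ : _ == _ = false) ?mulr0//; apply/negbTE; rewrite eq_sym.
  by rewrite sumr_const card_ord mulVf.
rewrite (le_trans (normc_cintegral_le _))//; first exact: ess_boundedM.
rewrite -KI; apply: ae_le_Rintegral.
- by apply: ess_bounded_normc; exact: ess_boundedM.
- exact: ess_bounded_normc.
- by move=> w; exact: normc_ge0.
- by move=> w; exact: normc_ge0.
- by apply: filterS f1 => w fw; rewrite Normc.normcM ler_piMl ?normc_ge0.
Qed.

End Fejer.

(** * From Fejer means to the Riesz projection of a bounded function *)

Section ExponentialIntegrability.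
Context {R : realType}.
Implicit Types (f g h : circle R -> R[i]).

(** Cauchy-Schwarz against the constant 1, of norm 1 on a probability space. *)
Lemma cLnorm1_le_cLnorm2 h : cmeasurable h ->
  (\int[sigma1 R]_z (normc (h z))%:E <= cLnorm 2%:E h)%E.
Proof.
move=> mh.
have := @hoelder _ _ _ (sigma1 R) (@Normc.normc R \o h) (cst 1) 2 2 (measurable_normc mh)
  (measurable_cst _) (ltr0n _ 2) (ltr0n _ 2).
have h2 : 2^-1 + 2^-1 = 1 :> R by lra.
move=> /(_ h2).
have -> : 'N[sigma1 R]_2%:E[EFin \o cst 1%R]%E = 1%E.
  by rewrite (Lnorm_cst1 (sigma1 R)) [X in (X `^ _)%E]probability_setT poweR1r.
rewrite Lnorm1 mule1.
apply: le_trans; apply: ge0_le_integral => //.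
- by move=> z _; rewrite lee_fin normc_ge0.
- by apply: measurableT_comp => //; exact: measurable_normc.
- do 2 apply: measurableT_comp => //.
  by apply: measurable_funM => //; exact: measurable_normc.
- by move=> z _; rewrite /= mulr1 lee_fin ler_norm.
Qed.

Lemma ess_bounded_riesz_partial f n : ess_bounded (riesz_partial f n).
Proof.
apply: ess_bounded_sum => k; apply: ess_boundedM; first exact: ess_bounded_cst.
exact: (ess_bounded_circleX k).
Qed.

Lemma cmeasurableB f g : cmeasurable f -> cmeasurable g ->
  cmeasurable (fun z => f z - g z).
Proof. by move=> mf mg; apply: cmeasurableD => //; exact: cmeasurableN. Qed.

Lemma measurable_normcE h : cmeasurable h ->
  measurable_fun setT (fun z => (normc (h z))%:E).
Proof. by move=> mh; apply: measurableT_comp => //; exact: measurable_normc. Qed.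

Lemma measurable_expR_min (c M : R) h : cmeasurable h ->
  measurable_fun setT (fun z => (expR (c * Num.min (normc (h z)) M))%:E).
Proof.
move=> mh; apply: measurableT_comp => //; apply: measurableT_comp => //.
apply: measurable_funM => //; apply: measurable_minr => //; exact: measurable_normc.
Qed.

(** The [L^2] convergence of the partial sums gives [L^1] distances tending to 0. By the triangle
    inequality, the distance from [g] to an average of partial sums is at most the Cesaro mean of
    these distances, which tends to 0 as well. *)
Lemma riesz_mean_cvg f g : is_riesz_projection f g ->
  exists2 a : nat -> R, a @ \oo --> (0 : R) & forall n,
    (\int[sigma1 R]_z (normc (g z - (fejer_pos f n.+1).[val z]))%:E <= (a n)%:E)%E.
Proof.
move=> [[mg g2] cg].
have mS n : cmeasurable (fun z => riesz_partial f n z - g z).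
  by apply: cmeasurableB => //; exact: (ess_bounded_riesz_partial f n).1.
pose d i := (\int[sigma1 R]_z (normc (riesz_partial f i.+1 z - g z))%:E)%E.
have d0 i : (0 <= d i)%E by apply: integral_ge0 => z _; rewrite lee_fin normc_ge0.
have dfin i : d i \is a fin_num.
  rewrite ge0_fin_numE//.
  have [mSi [M SM]] := ess_bounded_riesz_partial f i.+1.
  apply: (@le_lt_trans _ _ (\int[sigma1 R]_z
      ((normc (riesz_partial f i.+1 z))%:E + (normc (g z))%:E))%E).
    apply: ge0_le_integral => //.
    - by move=> z _; rewrite lee_fin normc_ge0.
    - exact: measurable_normcE.
    - by apply: emeasurable_funD; exact: measurable_normcE.
    - by move=> z _; rewrite -EFinD lee_fin -(normcNE (g z)) normcD_le.
  rewrite ge0_integralD//; last 4 first.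
  - by move=> z _; rewrite lee_fin normc_ge0.
  - exact: measurable_normcE.
  - by move=> z _; rewrite lee_fin normc_ge0.
  - exact: measurable_normcE.
  rewrite lte_add_pinfty//; last exact: le_lt_trans (cLnorm1_le_cLnorm2 mg) g2.
  have /integrableP[_] := ess_bounded_normc (ess_bounded_riesz_partial f i.+1).
  by apply: le_lt_trans; apply: ge0_le_integral => //;
   [move=> z _; rewrite lee_fin normc_ge0|exact: measurable_normcE|
    apply: measurableT_comp => //; exact: measurable_normcE|
    by move=> z _; rewrite lee_fin ler_norm].
have dc : d @ \oo --> 0%:E.
  apply: (@squeeze_cvge _ _ _ _ (cst 0%E) _
    (fun i => cLnorm 2%:E (fun z => riesz_partial f i.+1 z - g z))).
  - by apply: nearW => i; rewrite /= d0 cLnorm1_le_cLnorm2.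
  - exact: cvg_cst.
  - by rewrite (cvg_shiftS (fun n => cLnorm 2%:E (fun z => riesz_partial f n z - g z))).
exists (arithmetic_mean (fine \o d)).
  by apply: cesaro; exact: fine_cvg dc.
move=> n; have nR : 0 < n.+1%:R :> R by rewrite ltr0n.
apply: (@le_trans _ _ (\int[sigma1 R]_z ((n.+1%:R^-1)%:E *
   \sum_(i < n.+1) (normc (riesz_partial f i.+1 z - g z))%:E))%E).
  apply: ge0_le_integral => //.
  - by move=> z _; rewrite lee_fin normc_ge0.
  - apply: measurable_normcE; apply: cmeasurableB => //; exact: cmeasurable_horner.
  - apply: emeasurable_funM => //; apply: emeasurable_sum => i; exact: measurable_normcE.
  - move=> z _; rewrite sumEFin -EFinM lee_fin fejer_pos_mean.
    rewrite normc_distC.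
    have -> : n.+1%:R^-1 * (\sum_(i < n.+1) riesz_partial f i.+1 z) - g z =
       n.+1%:R^-1 * \sum_(i < n.+1) (riesz_partial f i.+1 z - g z).
      rewrite big_split /= sumr_const card_ord mulrDr; congr (_ + _).
      by rewrite -[X in _ * X]mulr_natl mulKf// pnatr_eq0.
    rewrite Normc.normcM Normc.normcV -(rmorph_nat (@real_complex R)) normc_real ger0_norm ?ler0n//.
    by rewrite ler_pM2l ?invr_gt0// normc_sum_le.
rewrite ge0_integralZl_EFin//; last 2 first.
- by move=> z _; rewrite sume_ge0// => i _; rewrite lee_fin normc_ge0.
- by apply: emeasurable_sum => i; exact: measurable_normcE.
rewrite ge0_integral_sum//; last 2 first.
- by move=> i; exact: measurable_normcE.
- by move=> i z _; rewrite lee_fin normc_ge0.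
rewrite /arithmetic_mean /= /series /= EFinM lee_pmul2l//.
rewrite big_mkord -sumEFin; apply: lee_sum => i _.
by rewrite fineK.
Qed.

(** Convergence in [L^1] does not control an exponential. Truncation at [M] bounds its slope, and
    then the estimate for Fejer means passes to [g]. *)
Lemma integral_expR_min_le (c : R) f g (M : R) : 0 < c -> c < pi ->
  cmeasurable f -> {ae sigma1 R, forall z, normc (f z) <= 1} ->
  is_riesz_projection f g ->
  (\int[sigma1 R]_z (expR (c * Num.min (normc (g z)) M))%:E <= (2 * expR c / cos (c / 2))%:E)%E.
Proof.
move=> c0 cpi mf f1 fg; have [a a0 ga] := riesz_mean_cvg fg.
have mg := fg.1.1.
apply/lee_addgt0Pr => e e0.
(* The largest slope of [exp (c r)] for [r <= M]. *)
pose k := c * expR (c * M).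
have k0 : 0 < k by rewrite mulr_gt0 ?expR_gt0.
have [n an] : exists n, a n < e / k.
  have /cvgrPdist_lt/(_ (e / k)) := a0.
  move=> /(_ (divr_gt0 e0 k0))[n _ /(_ n (leqnn n))] /=.
  by rewrite sub0r normrN => /(le_lt_trans (ler_norm _)) h; exists n.
have mF := cmeasurable_horner (fejer_pos f n.+1).
have mgF : cmeasurable (fun z => g z - (fejer_pos f n.+1).[val z]) by exact: cmeasurableB.
have meF : measurable_fun setT (fun z : circle R => (expR (c * normc (fejer_pos f n.+1).[val z]))%:E).
  apply: measurableT_comp => //; apply: measurableT_comp => //.
  by apply: measurable_funM => //; exact: measurable_normc.
apply: (@le_trans _ _ (\int[sigma1 R]_z ((expR (c * normc (fejer_pos f n.+1).[val z]))%:E +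
    k%:E * (normc (g z - (fejer_pos f n.+1).[val z]))%:E))%E).
  apply: ge0_le_integral => //.
  - exact: measurable_expR_min.
  - apply: emeasurable_funD => //; apply: emeasurable_funM => //; exact: measurable_normcE.
  - move=> z _; rewrite -EFinM -EFinD lee_fin.
    set r := normc (_.[_]); set h := Num.min _ _.
    have hM : h <= M by rewrite ge_min lexx orbT.
    have hr : h - r <= normc (g z - (fejer_pos f n.+1).[val z]).
      rewrite (@le_trans _ _ (normc (g z) - r))//; first by rewrite lerD2r ge_min lexx.
      rewrite lerBlDr; have := normcD_le (g z - (fejer_pos f n.+1).[val z]) (fejer_pos f n.+1).[val z].
      by rewrite subrK.
    (* [expR] lies above its tangent at [c * h] *)
    have e1 : expR (c * h) * (1 + c * (r - h)) <= expR (c * r).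
      have -> : expR (c * r) = expR (c * h) * expR (c * (r - h)).
        by rewrite -expRD; congr expR; ring.
      by rewrite ler_pM2l ?expR_gt0// expR_ge1Dx.
    have e2 : expR (c * h) <= expR (c * M) by rewrite ler_expR ler_pM2l.
    have e3 := expR_gt0 (c * h).
    have d0 := normc_ge0 (g z - (fejer_pos f n.+1).[val z]).
    have : expR (c * h) * c * (h - r) <= k * normc (g z - (fejer_pos f n.+1).[val z]).
      have [h0|h0] := leP (h - r) 0.
        rewrite (@le_trans _ _ 0)//; last by rewrite mulr_ge0// ltW.
        by rewrite mulr_ge0_le0// mulr_ge0// ltW.
      apply: ler_pM => //; [by rewrite mulr_ge0// ltW|exact: ltW|by rewrite mulrC ler_pM2l].
    have aux (x b y v q : R) : x * (1 + v * (q - y)) <= b ->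
        forall d, x * v * (y - q) <= d -> x <= b + d.
      by clear; move=> h1 d; lra.
    exact: (aux _ _ _ _ _ e1).
rewrite ge0_integralD; [|by []| | | | ]; last 4 first.
- by move=> z _; rewrite lee_fin expR_ge0.
- by [].
- by move=> z _; rewrite -EFinM lee_fin mulr_ge0 ?normc_ge0// ltW.
- by apply: emeasurable_funM => //; exact: measurable_normcE.
rewrite ge0_integralZl_EFin; [|by []| | | ]; last 3 first.
- by move=> z _; rewrite lee_fin normc_ge0.
- exact: measurable_normcE.
- exact: ltW.
apply: leeD.
  have := @integral_expR_trig_le R c (fejer_pos f n.+1) (fejer_neg f n.+1) c0 cpi
    (fejer_neg0 _ _) (fun z => fejer_le1 n.+1 z mf f1).
  rewrite -lee_fin; apply: le_trans.
  rewrite /Rintegral fineK//; apply: integrable_fin_num => //.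
  have [B hB] := horner_circle_bound (fejer_pos f n.+1).
  apply: (@ae_bounded_integrable _ _ (expR (c * B))).
    by apply: measurableT_comp => //; apply: measurable_funM => //; exact: measurable_normc.
  by apply/aeW => z; rewrite ger0_norm ?expR_ge0// ler_expR ler_pM2l.
rewrite (@le_trans _ _ (k%:E * (a n)%:E)%E)//; first by rewrite lee_pmul2l// ?lte_fin.
by rewrite -EFinM lee_fin mulrC -ler_pdivlMr// ltW.
Qed.

(** Monotone convergence removes the truncation, whose level does not enter the bound. At each point
    the truncated sequence is eventually constant. *)
Lemma integral_expR_riesz_le (c : R) f g : 0 < c -> c < pi ->
  cmeasurable f -> {ae sigma1 R, forall z, normc (f z) <= 1} ->
  is_riesz_projection f g ->
  (\int[sigma1 R]_z (expR (c * normc (g z)))%:E <= (2 * expR c / cos (c / 2))%:E)%E.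
Proof.
move=> c0 cpi mf f1 fg; have mg := fg.1.1.
pose e n z := (expR (c * Num.min (normc (g z)) n%:R))%:E.
have lime z : limn (e ^~ z) = (expR (c * normc (g z)))%:E.
  apply: lim_near_cst => //; near=> n.
  rewrite /e min_l//; near: n; exact: nbhs_infty_ger.
have ndE z m n : (m <= n)%N -> (e m z <= e n z)%E.
  by move=> mn; rewrite lee_fin ler_expR ler_pM2l// le_min2// ler_nat.
under eq_integral do rewrite -lime.
rewrite (@monotone_convergence _ _ _ (sigma1 R) setT measurableT e).
- apply: lime_le; last by apply: nearW => n; exact: (integral_expR_min_le _ c0 cpi mf f1 fg).
  apply: ereal_nondecreasing_is_cvgn => m n mn; apply: ge0_le_integral => //.
  + by move=> z _; rewrite lee_fin expR_ge0.
  + exact: measurable_expR_min.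
  + exact: measurable_expR_min.
  + by move=> z _; exact: ndE.
- by move=> n; exact: measurable_expR_min.
- by move=> n z _; rewrite lee_fin expR_ge0.
- by move=> z _ m n mn; exact: ndE.
Unshelve. all: by end_near. Qed.

End ExponentialIntegrability.

(** * The extremal sawtooth *)

Section Sawtooth.
Context {R : realType}.
Implicit Types (t : R) (n : nat).

(** With [k = i + 1] this is [(1 / k) (1 - k / (n + 1))]: the sine coefficient of [(pi - t) / 2]
    times the Fejer weight. *)
Definition saw_weight n i : R := i.+1%:R^-1 - n.+1%:R^-1.

Lemma saw_weight_ge0 n i : (i <= n)%N -> 0 <= saw_weight n i.
Proof. by move=> le_in; rewrite subr_ge0 lef_pV2 ?posrE ?ltr0n// ler_nat. Qed.

Lemma sum_sum_lt (c : nat -> R) n :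
  \sum_(i < n.+1) \sum_(k < i) c k = \sum_(k < n) (n%:R - k%:R) * c k.
Proof.
elim: n => [|n ih]; first by rewrite big_ord1 !big_ord0.
rewrite big_ord_recr /= ih.
have -> : \sum_(k < n) (n%:R - k%:R) * c k = \sum_(k < n.+1) (n%:R - k%:R) * c k.
  by rewrite big_ord_recr /= subrr mul0r addr0.
rewrite -big_split /=; apply: eq_bigr => k _.
by rewrite -natr1; ring.
Qed.

(** This is the squared modulus of [1 + v + ... + v^n] at [v = cis t], with the terms [v^(i - j)]
    collected by the value of [i - j]. *)
Lemma fejer_cos_ge0 n t :
  0 <= n.+1%:R + 2 * \sum_(k < n) (n%:R - k%:R) * cos (k.+1%:R * t).
Proof.
have vX m : Re (val (cis t) ^+ m) = cos (m%:R * t) by rewrite cisX.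
have vV m : Re (val (cis t) ^ (- m%:Z)) = cos (m%:R * t).
  by rewrite -exprnN -exprVn circleV -rmorphXn cisX.
have : 0 <= Re (\sum_(i < n.+1) \sum_(j < n.+1) val (cis t) ^ (i%:Z - j%:Z)).
  by rewrite fejer_kernel ?circle_neq0 ?circleV//= sqr_ge0.
move: (val (cis t)) vX vV => v vX vV.
have ReS m (F : 'I_m -> R[i]) : Re (\sum_(i < m) F i) = \sum_(i < m) Re (F i).
  by apply: (big_morph _ (@reD R)).
rewrite (sum_int_diff (fun k => v ^ k)) reD !ReS.
have e1 i : Re (\sum_(k < i.+1) v ^ k) = 1 + \sum_(k < i) cos (k.+1%:R * t).
  rewrite big_ord_recl reD expr0z ReS; congr (_ + _); apply: eq_bigr => k _.
  by rewrite -vX.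
have e2 i : Re (\sum_(k < i) v ^ (- k.+1%:Z)) = \sum_(k < i) cos (k.+1%:R * t).
  by rewrite ReS; apply: eq_bigr => k _; rewrite vV.
rewrite (eq_bigr (fun i : 'I_n.+1 => 1 + \sum_(k < i) cos (k.+1%:R * t)));
  last by move=> i _; exact: e1.
rewrite [X in _ <= _ + X](eq_bigr (fun i : 'I_n.+1 =>
  \sum_(k < i) cos (k.+1%:R * t))); last by move=> i _; exact: e2.
rewrite big_split /= sumr_const card_ord (sum_sum_lt (fun k => cos (k.+1%:R * t))).
by rewrite -addrA mulr_natl mulr2n.
Qed.

(* Fejer mean of the Fourier series of the sawtooth [(pi - t) / 2]. *)
Definition saw n t : R := \sum_(i < n) saw_weight n i * sin (i.+1%:R * t).

Lemma is_derive_saw n t :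
  is_derive t 1 (saw n) (\sum_(i < n) saw_weight n i * (i.+1%:R * cos (i.+1%:R * t))).
Proof.
rewrite (_ : saw n = \sum_(i < n) (fun t => saw_weight n i * sin (i.+1%:R * t))); last first.
  by apply/funext => s; rewrite fct_sumE.
apply: is_derive_sum => i; apply: is_derive_eq.
by rewrite /GRing.scale/=; ring.
Qed.

(** The sum is the derivative of [saw n]. Since [(i + 1) * saw_weight n i = (n - i) / (n + 1)],
    adding [1 / 2] to it gives half the Fejer kernel. *)
Lemma saw_derive_ge n t :
  - 2^-1 <= \sum_(i < n) saw_weight n i * (i.+1%:R * cos (i.+1%:R * t)).
Proof.
have := fejer_cos_ge0 n t.
have nR : 0 < n.+1%:R :> R by rewrite ltr0n.
have -> : \sum_(k < n) (n%:R - k%:R) * cos (k.+1%:R * t) =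
   n.+1%:R * \sum_(i < n) saw_weight n i * (i.+1%:R * cos (i.+1%:R * t)).
  rewrite mulr_sumr; apply: eq_bigr => i _; rewrite /saw_weight -!natr1.
  field; have : 0 <= n%:R :> R by []; have : 0 <= i%:R :> R by [].
  by move=> ? ?; rewrite !gt_eqF// ltr_wpDl.
rewrite mulrCA -[X in X + _]mulr1 -mulrDr pmulr_rge0//; lra.
Qed.

(** By [saw_derive_ge], [saw n s + s / 2] is nondecreasing. As [saw n] vanishes at 0 and at [pi], it
    lies between [- t / 2] and [(pi - t) / 2] on [[0, pi]]; oddness gives the other half. *)
Lemma norm_saw_le n t : - pi <= t -> t <= pi -> `|saw n t| <= pi / 2.
Proof.
move=> tl tr.
wlog t0 : t tl tr / 0 <= t.
  move=> h; have [t0|t0] := leP 0 t; first exact: h.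
  have -> : `|saw n t| = `|saw n (- t)|.
    rewrite -normrN /saw -sumrN; congr `|_|; apply: eq_bigr => i _.
    by rewrite mulrN sinN mulrN.
  by apply: h; move: tl tr t0; lra.
pose h s := saw n s + s / 2.
have dh (s : R) : is_derive s 1 h (\sum_(i < n) saw_weight n i * (i.+1%:R * cos (i.+1%:R * s)) + 2^-1).
  have ds := is_derive_saw n s.
  have d2 : is_derive s 1 (fun x : R => x / 2) 2^-1.
    apply: is_derive_eq; rewrite /GRing.scale/=; ring.
  exact: is_deriveD.
have hle x y : x <= y -> h x <= h y.
  move=> xy; rewrite -subr_ge0.
  have [c _ ->] := MVT_segment xy (fun t _ => dh t)
    (continuous_subspaceT (is_derive_continuous dh)).
  rewrite mulr_ge0 ?subr_ge0//; have := saw_derive_ge n c; lra.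
have s0 : saw n 0 = 0 by rewrite /saw big1// => i _; rewrite mulr0 sin0 mulr0.
have spi : saw n pi = 0.
  rewrite /saw big1// => i _.
  have : Im (val (cis (pi : R)) ^+ i.+1) = 0.
    have -> : val (cis (pi : R)) = ((-1)%:C)%C.
      by apply/eqP; rewrite eq_complex /= cospi sinpi !eqxx.
    by rewrite -rmorphXn.
  by rewrite cisX /= => ->; rewrite mulr0.
have h1 := hle _ _ t0; have h2 := hle _ _ tr.
rewrite /h s0 spi in h1 h2; rewrite ler_norml; apply/andP; split; lra.
Qed.

Lemma ln_le_harmonic n : ln n.+1%:R <= \sum_(i < n) i.+1%:R^-1 :> R.
Proof.
elim: n => [|n ih]; first by rewrite big_ord0 ln1.
rewrite big_ord_recr /=.
have nR : 0 < n.+1%:R :> R by rewrite ltr0n.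
have -> : n.+2%:R = n.+1%:R * (1 + n.+1%:R^-1) :> R.
  by rewrite mulrDr mulr1 mulfV ?gt_eqF// natr1.
have iV : 0 < n.+1%:R^-1 :> R by rewrite invr_gt0.
have V1 : 0 < 1 + n.+1%:R^-1 :> R by rewrite addr_gt0.
rewrite lnM ?posrE//.
by rewrite lerD// le_ln1Dx// (lt_trans _ iV)// ltrN10.
Qed.

(** For such [t] all angles [(i + 1) t] are at most 1, so replacing a cosine by 1 costs at most
    [1 / (2 (n + 1))] per term. The Fejer weight costs [1 / (n + 1)], so the [n] terms together lose
    less than 2 from the harmonic sum. *)
Lemma saw_cos_ge n t : 0 <= t -> t <= n.+1%:R^-1 ->
  ln n.+1%:R - 2 <= \sum_(i < n) saw_weight n i * cos (i.+1%:R * t).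
Proof.
move=> t0 tn.
have nR : 0 < n.+1%:R :> R by rewrite ltr0n.
have h (i : 'I_n) : i.+1%:R^-1 - 2 * n.+1%:R^-1 <= saw_weight n i * cos (i.+1%:R * t).
  have iR : 0 < i.+1%:R :> R by rewrite ltr0n.
  have w0 := saw_weight_ge0 (ltnW (ltn_ord i)).
  have wi : saw_weight n i <= i.+1%:R^-1 by rewrite lerBlDr lerDl invr_ge0 ler0n.
  have c1 := one_sub_cos_le (i.+1%:R * t).
  have c0 := cos_le1 (i.+1%:R * t).
  have it : i.+1%:R * t <= 1.
    rewrite (le_trans (ler_pM _ _ (lexx _) tn))//.
    by rewrite ler_pdivrMr// mul1r ler_nat ltnW// ltnS ltn_ord.
  have it0 : 0 <= i.+1%:R * t by rewrite mulr_ge0.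
  have : saw_weight n i * (1 - cos (i.+1%:R * t)) <= i.+1%:R^-1 * ((i.+1%:R * t) ^+ 2 / 2).
    by apply: ler_pM => //; rewrite subr_ge0.
  have -> : i.+1%:R^-1 * ((i.+1%:R * t) ^+ 2 / 2) = (i.+1%:R * t) * t / 2.
    by field; rewrite gt_eqF.
  rewrite {1}/saw_weight.
  have : i.+1%:R * t * t <= 1 * n.+1%:R^-1 by apply: ler_pM.
  rewrite /saw_weight; have : 0 < n.+1%:R^-1 :> R by rewrite invr_gt0.
  move: (i.+1%:R * t * t) (cos _) (n.+1%:R^-1) (i.+1%:R^-1) => x y a b.
  nra.
apply: (@le_trans _ _ (\sum_(i < n) (i.+1%:R^-1 - 2 * n.+1%:R^-1))); last exact: ler_sum.
rewrite big_split /= lerD ?ln_le_harmonic//.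
rewrite sumrN lerN2 sumr_const card_ord -[leLHS]mulr_natl mulrCA ler_piMr//.
by rewrite ler_pdivrMr// mul1r ler_nat.
Qed.

End Sawtooth.

(** * Fourier coefficients and Riesz projection of [P + Q^*] *)

Section TrigonometricRieszProjection.
Context {R : realType}.
Implicit Types (f g : circle R -> R[i]) (P Q : {poly R[i]}).

Lemma cLnormE (p : R) f :
  cLnorm p%:E f = ((\int[sigma1 R]_z (normc (f z) `^ p)%:E) `^ p^-1)%E.
Proof.
rewrite /cLnorm unlock.
rewrite (@eq_integral _ _ _ (sigma1 R) setT (fun z => (normc (f z) `^ p)%:E)) // => z _ /=.
by rewrite ger0_norm ?normc_ge0// poweR_EFin.
Qed.

Lemma measurable_powR_normc (p : R) f : cmeasurable f ->
  measurable_fun setT (fun z => (normc (f z) `^ p)%:E).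
Proof.
move=> mf; apply: measurableT_comp => //.
apply: (measurableT_comp (measurable_powR p)); exact: measurable_normc.
Qed.

Lemma cintegral_conj f : ess_bounded f ->
  cintegral (fun z => (f z)^*%C) = (cintegral f)^*%C.
Proof.
move=> bf; apply/eqP; rewrite eq_complex /=; apply/andP; split; apply/eqP.
  by apply: eq_Rintegral => z _; case: (f z).
rewrite -mulN1r -RintegralZl//; last exact: ess_bounded_Im.
by apply: eq_Rintegral => z _; rewrite mulN1r; case: (f z).
Qed.

Lemma fourier_coef_trig f P Q (k : nat) : Q.[0] = 0 ->
  (forall z, f z = P.[val z] + (Q.[val z])^*%C) -> fourier_coef f k%:Z = P`_k.
Proof.
move=> Q0 fE; rewrite /fourier_coef.
(* On the circle [Q^* z^(-k)] is the conjugate of [Q * 'X^k], whose mean is its value at 0; [Q.[0] =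
   0] makes it vanish even for [k = 0]. *)
have -> : (fun z => f z * val z ^ (- k%:Z)) =
   (fun z => P.[val z] * val z ^ (- k%:Z) + ((Q * 'X^k).[val z])^*%C).
  apply/funext => z; rewrite fE mulrDl; congr (_ + _).
  rewrite hornerM hornerXn [RHS]rmorphM [X in _ = _ * X]rmorphXn.
  by rewrite -[X in _ = _ * X ^+ _]circleV exprVn exprnN.
have bX := @ess_bounded_circleX R.
have bQ := ess_bounded_horner (Q * 'X^k).
have bQc : ess_bounded (fun z : circle R => ((Q * 'X^k).[val z])^*%C).
  exact: ess_bounded_conj.
have bPX : ess_bounded (fun z : circle R => P.[val z] * val z ^ (- k%:Z)).
  by apply: ess_boundedM; [exact: ess_bounded_horner|exact: bX].
rewrite (cintegralD bPX bQc).
rewrite cintegral_conj// cintegral_horner hornerM Q0 mul0r rmorph0 addr0.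
under eq_fun do rewrite horner_coef mulr_suml.
have bt (i : nat) : ess_bounded (fun z : circle R => val z ^+ i * val z ^ (- k%:Z)).
  exact: (ess_boundedM (bX i) (bX _)).
rewrite cintegral_sum; last first.
  move=> i; under eq_fun do rewrite -mulrA.
  by apply: ess_boundedM => //; exact: ess_bounded_cst.
have ti (i : nat) :
    cintegral (fun z : circle R => P`_i * val z ^+ i * val z ^ (- k%:Z)) = P`_i * (i == k)%:R.
  under eq_fun do rewrite -mulrA.
  rewrite cintegralZ//; congr (_ * _).
  have -> : (fun z : circle R => val z ^+ i * val z ^ (- k%:Z)) = (fun z => val z ^ (i%:Z - k%:Z)).
    by apply/funext => z; rewrite expfzDr ?circle_neq0.
  by rewrite cintegral_circleXz subr_eq0.
under eq_bigr do rewrite ti.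
have [kP|kP] := ltnP k (size P).
  rewrite (bigD1 (Ordinal kP))//= eqxx mulr1 big1 ?addr0// => i.
  by rewrite -val_eqE /= => /negbTE ->; rewrite mulr0.
rewrite (nth_default _ kP) big1// => i _.
by rewrite ltn_eqF ?mulr0// (leq_trans (ltn_ord i)).
Qed.

Lemma riesz_partial_trig f P Q n z : Q.[0] = 0 ->
  (forall z, f z = P.[val z] + (Q.[val z])^*%C) -> (size P <= n)%N ->
  riesz_partial f n z = P.[val z].
Proof.
move=> Q0 fE Pn; rewrite /riesz_partial big_mkord (horner_coef_wide _ Pn).
by apply: eq_bigr => k _; rewrite (fourier_coef_trig k Q0 fE).
Qed.

Lemma is_riesz_projection_trig f P Q : Q.[0] = 0 ->
  (forall z, f z = P.[val z] + (Q.[val z])^*%C) ->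
  is_riesz_projection f (fun z => P.[val z]).
Proof.
move=> Q0 fE; have [mP [M PM]] := ess_bounded_horner P.
split.
  split => //; rewrite cLnormE poweR_lty//.
  apply: (@le_lt_trans _ _ (\int[sigma1 R]_z (cst (Num.max M 0 `^ 2)%:E z))%E).
    apply: ae_ge0_le_integral => //.
    - by move=> z _; rewrite lee_fin powR_ge0.
    - exact: measurable_powR_normc.
    - by move=> z _; rewrite lee_fin powR_ge0.
    - apply: filterS PM => z Pz _; rewrite lee_fin ge0_ler_powR ?nnegrE ?normc_ge0 ?le_max ?lexx ?orbT//.
      by rewrite Pz.
  by rewrite integral_cst// [X in (_ * X)%E]probability_setT mule1 ltry.
apply: cvg_near_cst; exists (size P) => // n /= Pn.
rewrite /cLnorm (@eq_Lnorm _ _ _ _ _ _ (cst 0%E)) ?Lnorm0//.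
move=> z /=; rewrite (riesz_partial_trig _ Q0 fE)// subrr.
by rewrite Normc.normc0.
Qed.

(** [riesz_projection f] is a chosen representative. It agrees with [P] almost everywhere, both
    being [L^2] limits of partial sums that equal [P] from the index [size P] on. *)
Lemma cLnorm_riesz_projection_trig f P Q (p : R) : Q.[0] = 0 ->
  (forall z, f z = P.[val z] + (Q.[val z])^*%C) ->
  cLnorm p%:E (riesz_projection f) = cLnorm p%:E (fun z => P.[val z]).
Proof.
move=> Q0 fE; have mP := cmeasurable_horner P.
have [[mg _] cg] : is_riesz_projection f (riesz_projection f).
  apply: (@xgetPex _ _ [set g | is_riesz_projection f g]).
  exists (fun z => P.[val z]); exact: is_riesz_projection_trig Q0 fE.
set g := riesz_projection f in mg cg *.
have d0 : cLnorm 2%:E (fun z => P.[val z] - g z) = 0%E.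
  apply/esym; apply: (cvg_unique _ cg) => //; apply: cvg_near_cst.
  exists (size P) => // n /= Pn; congr (cLnorm _ _); apply/funext => z.
  by rewrite (riesz_partial_trig _ Q0 fE).
have mPg : cmeasurable (fun z => P.[val z] - g z) by exact: cmeasurableB.
have := @Lnorm_eq0_eq0 _ _ _ (sigma1 R) (fun z => (normc (P.[val z] - g z))%:E) 2%:E
  (measurable_normcE mPg) (ltr0n _ 2) d0.
move=> ae0.
have E : (\int[sigma1 R]_z (normc (g z) `^ p)%:E =
          \int[sigma1 R]_z (normc (P.[val z]) `^ p)%:E)%E.
  apply: ae_eq_integral => //; [exact: measurable_powR_normc|exact: measurable_powR_normc|].
  apply: filterS ae0 => z /= + _ => /(_ I) [] Pg.
  have /eqP := Normc.eq0_normc Pg.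
  by rewrite subr_eq0 => /eqP ->.
by rewrite !cLnormE E.
Qed.

End TrigonometricRieszProjection.

(** * Bounds on the operator norm and their limit *)

Section OperatorNorm.
Context {R : realType}.
Implicit Types (p c : R) (n : nat).

(** Since [Re (- i z^k) = sin (k t)], the function [P + P^*] is [(2 / pi) saw n], the Fejer mean of
    [1 - t / pi]. The imaginary part of [P] is the cosine sum that is large near the jump. *)
Definition saw_poly n : {poly R[i]} :=
  \sum_(i < n) (Complex 0 (- (saw_weight n i / pi)) *: 'X^(i.+1)).

Lemma saw_poly0 n : (saw_poly n).[0] = 0.
Proof.
by rewrite /saw_poly horner_sum big1// => i _; rewrite hornerZ hornerXn expr0n mulr0.
Qed.

Lemma saw_polyE n (t : R) : (saw_poly n).[val (cis t)] =
  Complex (saw n t / pi) (- ((\sum_(i < n) saw_weight n i * cos (i.+1%:R * t)) / pi)).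
Proof.
rewrite /saw_poly horner_sum.
have cE (x y : R) : Complex x y = (x%:C)%C + Complex 0 y.
  by apply/eqP; rewrite eq_complex /= addr0 add0r !eqxx.
apply/eqP; rewrite eq_complex; apply/andP; split; apply/eqP => /=.
  rewrite (big_morph _ (@reD R) (erefl _)) /saw mulr_suml.
  apply: eq_bigr => i _; rewrite hornerZ hornerXn cisX /=; ring.
rewrite (big_morph _ (@imD R) (erefl _)) mulr_suml -sumrN.
apply: eq_bigr => i _; rewrite hornerZ hornerXn cisX /=; ring.
Qed.

Lemma saw_poly_unit n (z : circle R) :
  normc ((saw_poly n).[val z] + ((saw_poly n).[val z])^*%C) <= 1.
Proof.
have [t [tl tr ->]] := circle_cis z; rewrite saw_polyE.
set b := - (_ / _).
have -> : Complex (saw n t / pi) b + (Complex (saw n t / pi) b)^*%C =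
    ((2 / pi * saw n t)%:C)%C.
  by apply/eqP; rewrite eq_complex /=; apply/andP; split; apply/eqP; ring.
rewrite normc_real normrM ger0_norm ?divr_ge0 ?pi_ge0//.
have p0 := pi_gt0 R.
rewrite (@le_trans _ _ (2 / pi * (pi / 2)))//.
  by rewrite ler_pM2l ?norm_saw_le// divr_gt0.
by rewrite mulrA mulfVK ?gt_eqF// mulfV// pnatr_eq0.
Qed.

Lemma cLnormy_le1 (f : circle R -> R[i]) : cmeasurable f -> 
  (cLnorm +oo f <= 1)%E <-> {ae sigma1 R, forall z, normc (f z) <= 1}.
Proof.
move=> mf; rewrite /cLnorm unlock [X in (0 < X)%E]probability_setT lte01.
split.
  move/ess_supP; apply: filterS => z; rewrite /= lee_fin.
  by rewrite ger0_norm ?normc_ge0.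
move=> f1; apply/ess_supP; apply: filterS f1 => z; rewrite /= lee_fin.
by rewrite ger0_norm ?normc_ge0.
Qed.

Lemma saw_opnorm_ge n p : (cLnorm p%:E (fun z => (saw_poly n).[val z]) <= riesz_opnorm p%:E)%E.
Proof.
apply: ereal_sup_ubound => /=.
pose f (z : circle R) : R[i] := (saw_poly n).[val z] + ((saw_poly n).[val z])^*%C.
exists f; last exact: (cLnorm_riesz_projection_trig _ (saw_poly0 n)).
have mf : cmeasurable f.
  apply: cmeasurableD; [|apply: cmeasurable_conj]; exact: cmeasurable_horner.
have f1 : (cLnorm +oo f <= 1)%E.
  by apply/cLnormy_le1 => //; apply/aeW => z; exact: saw_poly_unit.
by split => //; split => //; rewrite (le_lt_trans f1)// ltry.
Qed.

(** Only the arc [0 <= t <= 1 / (n + 1)] is kept, and there only the imaginary part. *)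
Lemma saw_integral_ge n p (b : R) : 0 <= p -> 0 <= b -> b <= (ln n.+1%:R - 2) / pi ->
  (((2 * pi)^-1 * (b `^ p * n.+1%:R^-1))%:E <=
   \int[sigma1 R]_z (normc (saw_poly n).[val z] `^ p)%:E)%E.
Proof.
move=> p0 b0 bn; have mP := cmeasurable_horner (saw_poly n).
have mh : measurable_fun setT (fun z : circle R => normc (saw_poly n).[val z] `^ p).
  apply: (measurableT_comp (measurable_powR p)); exact: measurable_normc.
rewrite (@ge0_integral_sigma1 R (fun z => normc (saw_poly n).[val z] `^ p))//; last first.
  by move=> z; exact: powR_ge0.
have N0 : 0 < n.+1%:R^-1 :> R by rewrite invr_gt0 ltr0n.
have N1 : n.+1%:R^-1 <= 1 :> R by rewrite invf_le1 ?ltr0n// ler1n.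
have pi1 : 1 <= pi :> R by have := pi_ge2 R; lra.
rewrite EFinM lee_pmul2l//; last by rewrite lte_fin invr_gt0 pi2_gt0.
have mc : measurable_fun [set: measurableTypeR R] (fun t => (normc (saw_poly n).[val (cis t)] `^ p)%:E).
  apply: measurableT_comp => //; exact: (measurableT_comp mh (@measurable_cis R)).
pose d : R := n.+1%:R^-1; rewrite -/d in N0 N1 *.
have sub : (\int[lebesgue_measure]_(t in `[0%R, d])
    (normc (saw_poly n).[val (cis t)] `^ p)%:E <=
  \int[lebesgue_measure]_(t in `[0%R, (2 * pi)%R])
    (normc (saw_poly n).[val (cis t)] `^ p)%:E)%E.
  apply: ge0_subset_integral => //.
  - exact: measurable_funTS mc.
  - by move=> t _; rewrite lee_fin powR_ge0.
  - move=> t; rewrite /= !in_itv/= => /andP[-> tN] /=; lra.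
refine (le_trans _ sub).
apply: (@le_trans _ _ (\int[lebesgue_measure]_(t in `[0%R, d]) (cst (b `^ p)%:E t))%E).
  rewrite integral_cst//= lebesgue_measure_itv /= lte_fin N0 -EFinB subr0.
  by rewrite -EFinM.
apply: ge0_le_integral => //.
- by move=> t _; rewrite lee_fin powR_ge0.
- exact: measurable_funTS mc.
move=> t; rewrite /= in_itv/= => /andP[t0 tN]; rewrite lee_fin.
apply: ge0_ler_powR => //; rewrite ?nnegrE ?normc_ge0//.
apply: (le_trans bn); rewrite saw_polyE.
set S := \sum_(i < n) _.
apply: (le_trans _ (ler_norm_Im _)) => /=.
rewrite normrN (le_trans _ (ler_norm _))// ler_pM2r ?invr_gt0 ?pi_gt0//.
exact: saw_cos_ge.
Qed.

Lemma riesz_opnorm_ge p : 2 <= p ->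
  (((p - 2) / (pi * expR 1) * (4 * pi) `^ (- p^-1))%:E <= riesz_opnorm p%:E :> \bar R)%E.
Proof.
move=> p2; have p0 : 0 < p by lra.
have pn0 : p != 0 by rewrite gt_eqF.
have pi0 := pi_gt0 R.
have E1 : 1 <= expR p by have := expR_ge1Dx p; lra.
(* [`|P f| >= (ln n - 2) / pi] on an arc of length [1 / n]: optimal for [n ~ expR p] *)
pose n := Num.truncn (expR p).
have /andP[n1 n2] : n%:R <= expR p < n.+1%:R by apply: truncn_itv; rewrite expR_ge0.
have nR : 0 < n.+1%:R :> R by rewrite ltr0n.
pose b := (p - 2) / pi.
have b0 : 0 <= b by rewrite divr_ge0 ?pi_ge0// subr_ge0.
have bn : b <= (ln n.+1%:R - 2) / pi.
  rewrite ler_pM2r ?invr_gt0// lerD2r -[leLHS]expRK ler_ln ?posrE ?expR_gt0//.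
  exact: ltW.
apply: le_trans (saw_opnorm_ge n p); rewrite cLnormE.
(* In [4 * pi], the factor [2 * pi] is the normalization of [sigma1]; the other 2 comes from
   [n + 1 <= 2 exp p]. *)
apply: (@le_trans _ _ (((b `^ p * expR (- p) / (4 * pi)) `^ p^-1)%:E)).
  rewrite lee_fin.
  have -> : b `^ p * expR (- p) / (4 * pi) = (b * expR (- 1)) `^ p * (4 * pi)^-1.
    by rewrite powRM ?expR_ge0// -expRM mulN1r.
  rewrite [leRHS]powRM ?powR_ge0 ?invr_ge0 ?mulr_ge0 ?pi_ge0//.
  rewrite -powRrM mulfV// powRr1; last by rewrite mulr_ge0 ?expR_ge0.
  rewrite -[(4 * pi)^-1]powR_inv1 ?mulr_ge0 ?pi_ge0// -powRrM mulN1r /b expRN.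
  by rewrite invfM mulrA.
rewrite -poweR_EFin; apply: gt0_ler_poweR; rewrite ?invr_ge0 ?(ltW p0)//.
- by rewrite in_itv/= leey andbT lee_fin divr_ge0 ?mulr_ge0 ?powR_ge0 ?expR_ge0 ?pi_ge0.
- by rewrite in_itv/= leey andbT integral_ge0// => z _; rewrite lee_fin powR_ge0.
apply: le_trans (saw_integral_ge (ltW p0) b0 bn); rewrite lee_fin.
have -> : b `^ p * expR (- p) / (4 * pi) = (2 * pi)^-1 * (b `^ p * (expR (- p) / 2)).
  move: (b `^ p) (expR (- p)) (pi : R) pi0 => x y q q0.
  field.
  by rewrite gt_eqF.
rewrite ler_pM2l ?invr_gt0 ?pi2_gt0//; apply: ler_wpM2l; first exact: powR_ge0.
rewrite expRN -invfM lef_pV2 ?posrE ?mulr_gt0 ?expR_gt0//.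
rewrite -natr1; lra.
Qed.

(** The inequality [x <= exp (x - 1)] at [x = c r / p], raised to the power [p]; equality holds at
    [r = p / c]. *)
Lemma powR_le_expR c p (r : R) : 0 < c -> 0 < p -> 0 <= r ->
  r `^ p <= (p / (c * expR 1)) `^ p * expR (c * r).
Proof.
move=> c0 p0 r0; have pn0 : p != 0 by rewrite gt_eqF.
have ce : 0 < c * expR 1 by rewrite mulr_gt0 ?expR_gt0.
have -> : expR (c * r) = expR (c * r / p) `^ p by rewrite -expRM mulfVK.
rewrite -powRM ?expR_ge0 ?divr_ge0 ?(ltW ce) ?(ltW p0)//.
apply: ge0_ler_powR; rewrite ?nnegrE ?mulr_ge0 ?expR_ge0 ?invr_ge0 ?(ltW p0) ?(ltW ce)//.
have h := expR_ge1Dx (c * r / p - 1).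
rewrite [leLHS](_ : r = p / c * (1 + (c * r / p - 1))); last first.
  by field; rewrite pn0 gt_eqF.
rewrite (@le_trans _ _ (p / c * expR (c * r / p - 1)))//.
  by rewrite ler_pM2l// divr_gt0.
rewrite expRD expRN [leLHS](_ : _ = p / (c * expR 1) * expR (c * r / p))//.
by field; rewrite !gt_eqF ?expR_gt0.
Qed.

Lemma riesz_opnorm_le c p : 0 < c -> c < pi -> 0 < p ->
  (riesz_opnorm p%:E <= (p / (c * expR 1) * (2 * expR c / cos (c / 2)) `^ p^-1)%:E :> \bar R)%E.
Proof.
move=> c0 cpi p0; have pn0 : p != 0 by rewrite gt_eqF.
have c2 : 0 < cos (c / 2) by apply: cos_gt0_pihalf; have := pi_gt0 R; lra.
set K := 2 * expR c / cos (c / 2).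
have K0 : 0 < K by rewrite divr_gt0// mulr_gt0// expR_gt0.
have q0 : 0 <= p / (c * expR 1) by rewrite divr_ge0 ?mulr_ge0 ?expR_ge0// ltW.
apply: ge_ereal_sup => _ [f [[mf _] f1] <-]; rewrite cLnormE.
have {}f1 := (cLnormy_le1 mf).1 f1.
have -> : p / (c * expR 1) * K `^ p^-1 = ((p / (c * expR 1)) `^ p * K) `^ p^-1.
  by rewrite powRM ?powR_ge0 ?(ltW K0)// -powRrM mulfV// powRr1.
rewrite -poweR_EFin; apply: gt0_ler_poweR; rewrite ?invr_ge0 ?(ltW p0)//.
- by rewrite in_itv/= leey andbT integral_ge0// => z _; rewrite lee_fin powR_ge0.
- by rewrite in_itv/= leey andbT lee_fin mulr_ge0 ?powR_ge0// ltW.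
(* If [f] had no representative, [riesz_projection f] would be the default 0, for which the bound is
   immediate. *)
rewrite /riesz_projection; case: xgetP => [g _ fg|_]; last first.
  under eq_integral do rewrite Normc.normc0 powR0//.
  by rewrite integral0 lee_fin mulr_ge0 ?powR_ge0// ltW.
have mg := fg.1.1.
have mE : measurable_fun setT (fun z => (expR (c * normc (g z)))%:E).
  apply: measurableT_comp => //; apply: measurableT_comp => //.
  by apply: measurable_funM => //; exact: measurable_normc.
apply: (@le_trans _ _ (\int[sigma1 R]_z (((p / (c * expR 1)) `^ p)%:E * (expR (c * normc (g z)))%:E))%E).
  apply: ge0_le_integral => //.
  - by move=> z _; rewrite lee_fin powR_ge0.
  - exact: measurable_powR_normc.
  - by apply: emeasurable_funM.
  - by move=> z _; rewrite -EFinM lee_fin powR_le_expR ?normc_ge0.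
rewrite ge0_integralZl_EFin ?powR_ge0//.
rewrite EFinM lee_wpmul2l ?lee_fin ?powR_ge0//.
exact: integral_expR_riesz_le c0 cpi mf f1 fg.
Qed.

End OperatorNorm.

Section Limit.
Context {R : realType}.

Lemma cvg_invr_pinfty : (p^-1 : R) @[p --> +oo] --> (0 : R).
Proof.
apply/gtr0_cvgV0; last exact: cvg_id.
exact: nbhs_pinfty_gt.
Qed.

Lemma cvg_powR_invr_pinfty (K : R) : 0 < K -> K `^ p^-1 @[p --> +oo] --> (1 : R).
Proof.
move=> K0.
rewrite (_ : (fun p : R => K `^ p^-1) = (fun p => expR (p^-1 * ln K))); last first.
  by apply/funext => p; rewrite /powR gt_eqF.
rewrite -expR0 -(mul0r (ln K)).
apply: continuous_cvg; first exact: continuous_expR.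
by apply: cvgMr_tmp; exact: cvg_invr_pinfty.
Qed.

End Limit.

Unset Implicit Arguments.

Theorem theorem2 (R : realType) :
  (riesz_opnorm p%:E / p%:E)%E @[p --> +oo] --> ((pi * expR 1)^-1 : R)%:E.
Proof.
set L : R := (pi * expR 1)^-1.
have pi0 := pi_gt0 R; have e0 := expR_gt0 (1 : R).
have L0 : 0 < L by rewrite invr_gt0 mulr_gt0.
pose up (c p : R) := (c * expR 1)^-1 * (2 * expR c / cos (c / 2)) `^ p^-1.
pose lo (p : R) := L * (1 - 2 * p^-1) * ((4 * pi)^-1) `^ p^-1.
have divE (p : R) : 0 < p -> (riesz_opnorm p%:E / p%:E = riesz_opnorm p%:E * (p^-1)%:E :> \bar R)%E.
  by move=> p0; rewrite inver gt_eqF.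
have leup c p : 0 < c -> c < pi -> 0 < p -> (riesz_opnorm p%:E / p%:E <= (up c p)%:E :> \bar R)%E.
  move=> c0 cpi p0; rewrite divE//.
  have := riesz_opnorm_le c0 cpi p0.
  have p0' : (0 < (p^-1)%:E :> \bar R)%E by rewrite lte_fin invr_gt0.
  rewrite -(lee_pmul2r _ p0')// -EFinM => /le_trans; apply.
  rewrite lee_fin /up [leLHS](_ : _ = (c * expR 1)^-1 * (2 * expR c / cos (c / 2)) `^ p^-1)//.
  by field; rewrite !gt_eqF.
have gelo p : 2 <= p -> ((lo p)%:E <= riesz_opnorm p%:E / p%:E :> \bar R)%E.
  move=> p2; have p0 : 0 < p by lra.
  rewrite divE//.
  have := riesz_opnorm_ge p2.
  have p0' : (0 < (p^-1)%:E :> \bar R)%E by rewrite lte_fin invr_gt0.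
  rewrite -(lee_pmul2r _ p0')// -EFinM; apply: le_trans.
  have -> : (4 * pi) `^ (- p^-1) = (4 * pi)^-1 `^ p^-1.
    by rewrite -[(4 * pi)^-1]powR_inv1 ?mulr_ge0 ?pi_ge0// -powRrM mulN1r.
  rewrite lee_fin /lo [leRHS](_ : _ = L * (1 - 2 * p^-1) * (4 * pi)^-1 `^ p^-1)//.
  rewrite /L; move: ((4 * pi)^-1 `^ p^-1) (pi : R) pi0 (expR 1 : R) e0 => x q q0 y y0.
  field.
  by rewrite !gt_eqF.
have cpi (c : R) : 0 < c -> c < pi -> 0 < 2 * expR c / cos (c / 2).
  move=> c0 cpi; rewrite divr_gt0 ?mulr_gt0 ?expR_gt0//.
  by apply: cos_gt0_pihalf; lra.
have cup c : 0 < c -> c < pi -> up c p @[p --> +oo] --> (c * expR 1)^-1.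
  move=> c0 c1; rewrite -[X in _ --> X]mulr1.
  by apply: cvgMl_tmp; apply: cvg_powR_invr_pinfty; exact: cpi.
have clo : lo p @[p --> +oo] --> L.
  rewrite -[X in _ --> X]mulr1; apply: cvgM; last first.
    by apply: cvg_powR_invr_pinfty; rewrite invr_gt0 mulr_gt0.
  rewrite -[X in _ --> X]mulr1; apply: cvgMl_tmp.
  rewrite -[X in _ --> X]subr0; apply: cvgB; first exact: cvg_cst.
  by rewrite -[X in _ --> X](mulr0 2); apply: cvgMl_tmp; exact: cvg_invr_pinfty.
have fin p : 2 <= p -> (riesz_opnorm p%:E / p%:E)%E \is a (@fin_num R).
  move=> p2; rewrite fin_numE; apply/andP; split.
    by rewrite -ltNye (lt_le_trans _ (gelo _ p2))// ltNyr.
  (* Any [c] below [pi] gives finiteness; here [c = 1]. *)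
  rewrite -ltey (le_lt_trans (leup 1 p _ _ _))// ?ltry//; last lra.
  by have := pi_ge2 R; lra.
apply/fine_cvgP; split.
  near=> p; apply: fin; near: p; exact: nbhs_pinfty_ge.
apply/cvgrPdist_le => e e0'.
(* Chosen so that [up c] tends to [L + e / 2]; [c < pi] because this limit exceeds [L]. The other
   half of [e] pays for the convergence in [p]. *)
pose c := ((L + e / 2) * expR 1)^-1.
have Le : 0 < L + e / 2 by rewrite addr_gt0// divr_gt0.
have c0 : 0 < c by rewrite invr_gt0 mulr_gt0.
have ce : (c * expR 1)^-1 = L + e / 2.
  by rewrite /c invfM invrK mulfK ?gt_eqF.
have c1 : c < pi.
  rewrite -(invrK pi) ltf_pV2 ?posrE ?invr_gt0 ?mulr_gt0//.
  have -> : pi^-1 = L * expR 1 by rewrite /L invfM mulfVK ?gt_eqF.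
  by rewrite ltr_pM2r// ltrDl divr_gt0.
have e2 : 0 < e / 2 by rewrite divr_gt0.
near=> p.
have p2 : 2 <= p by near: p; exact: nbhs_pinfty_ge.
have p0 : 0 < p by lra.
have h1 : `|L + e / 2 - up c p| <= e / 2.
  rewrite -ce; near: p; move/cvgrPdist_le : (cup c c0 c1); exact.
have h2 : `|L - lo p| <= e.
  by near: p; move/cvgrPdist_le : clo; exact.
have /fineK xE := fin _ p2.
have := gelo _ p2; have := leup _ _ c0 c1 p0.
rewrite /= -xE !lee_fin; move: h1 h2; rewrite !ler_norml => /andP[? ?] /andP[? ?] ? ?.
by apply/andP; split; lra.
Unshelve. all: by end_near. Qed.
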